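(* Let $q:[0,\infty)\to\mathbb{C}^n$ be continuous, and let $c\ge0$ and $\gamma\in\mathbb{R}$ be such that $|S(t)|_{L_c(C_{cn},C_{cn})}\le c\,e^{\gamma t}$ for all $t\ge0$. For $\phi\in C_{cn}$ let $w^{\phi}:[-h,\infty)\to\mathbb{C}^n$ be the unique solution of $\frac{d}{dt}(w(t)-Lw_t)=Rw_t+q(t)$ with $w_0=\phi$. Then for all $\phi\in C_{cn}$ and for all $t\ge0$ we have $$|w^{\phi}(t)|\le c\left(e^{\gamma t}|\phi|+n\int_0^te^{\gamma(t-s)}|q(s)|\,ds\right).$$
   Context: Let $n\in\mathbb{N}$, $h>0$, $I=[-h,0]$. $|\cdot|$ denotes a norm on $\mathbb{C}^n$. $C_{cn}$ is the Banach space of continuous maps $I\to\mathbb{C}^n$, with $|\phi|=\max_{t\in I}|\phi(t)|$. For a map $v$ on $M\subset\mathbb{R}$ and $t$ with $[t-h,t]\subset M$, the segment $v_t$ is the map on $I$ given by $v_t(s)=v(t+s)$. For normed linear spaces $X,Y$ over $\mathbb{C}$, $L_c(X,Y)$ is the space of continuous linear maps $X\to Y$ with the operator norm $|T|=\sup_{|x|=1}|Tx|$. Standing assumption: $L,R\in L_c(C_{cn},\mathbb{C}^n)$, and ($\Delta$): there is $\Delta\in(0,h)$ with $L\phi=0$ for all $\phi\in C_{cn}$ with $\phi(t)=0$ on $[-h,-\Delta]$. Solutions. A solution of $\frac{d}{dt}(v(t)-Lv_t)=Rv_t+q(t)$ is a continuous map $v:[-h,\infty)\to\mathbb{C}^n$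 such that $[0,\infty)\ni t\mapsto v(t)-Lv_t\in\mathbb{C}^n$ is differentiable and satisfies the equation for all $t\ge0$ (right derivative at $t=0$). For every $\phi\in C_{cn}$ there is exactly one solution with initial segment $\phi$. For $q=0$ it is denoted $v^{\phi}$, and the maps $S(t):C_{cn}\to C_{cn}$, $S(t)\phi=v^{\phi}_t$, $t\ge0$, are continuous and linear and form a strongly continuous semigroup. *)

(* Defs.v *)
From HB Require Import structures.
From mathcomp Require Import all_boot all_order all_algebra.
From mathcomp Require Import all_classical all_reals all_analysis.
From mathcomp Require Export complex.

Set Implicit Arguments.
Unset Strict Implicit.
Unset Printing Implicit Defensive.

Import Order.TTheory GRing.Theory Num.Theory.
Import numFieldNormedType.Exports.

Local Open Scope classical_set_scope.
Local Open Scope ring_scope.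
Local Open Scope complex_scope.

(* The topology of K[i] is the one of its modulus; 'cV[K[i]]_n then carries the
   topology of the entrywise maximum norm, i.e. of any norm on C^n. *)
#[warnings="-redundant-canonical-projection"]
HB.instance Definition _ (K : rcfType) := NormedModule.copy K[i] K[i]^o.

Section Norms.
Context {K : realType}.

(* `|a| is the modulus of a, as an element of K[i] with zero imaginary part. *)
Record is_norm (V : lmodType K[i]) (N : V -> K) : Prop := IsNorm {
  is_norm_eq0 : forall x, N x = 0 -> x = 0;
  is_normZ : forall a x, N (a *: x) = complex.Re `|a| * N x;
  is_normD : forall x y, N (x + y) <= N x + N y }.

Definition continuous_for_norms (V W : zmodType) (NV : V -> K) (NW : W -> K)
    (T : V -> W) : Prop :=
  forall x e, 0 < e ->
    exists2 d, 0 < d & forall y, NV (y - x) < d -> NW (T y - T x) < e.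

(* Extended-real valued, so that a bound on it is a genuine bound even without
   knowing beforehand that T is bounded. *)
Definition opnorm (V W : Type) (NV : V -> K) (NW : W -> K) (T : V -> W)
    : \bar K :=
  ereal_sup [set (NW (T x))%:E | x in [set x | NV x = 1]].

End Norms.

Section ContinuousSegments.
Context {K : realType}.

Definition Ih (h : K) : Type := set_type `[- h, 0].
HB.instance Definition _ (h : K) := Topological.on (Ih h).

Definition Ccn (h : K) (n : nat) : Type := continuousType (Ih h) 'cV[K[i]]_n.

Variables (h : K) (n : nat).
Local Notation C := (Ccn h n).

HB.instance Definition _ := Choice.on C.

Lemma Ccn_continuous (phi : C) : continuous (phi : Ih h -> 'cV[K[i]]_n).
Proof. exact: cts_fun. Qed.

Lemma CcnP (phi psi : C) : (forall s, phi s = psi s) -> phi = psi.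
Proof. by move=> e; apply/continuousEP => s; exact: e. Qed.

Definition mkCcn (f : Ih h -> 'cV[K[i]]_n) (cf : continuous f) : C :=
  [the continuousType _ _ of mkcts cf].

Fact Ccn0_subproof : continuous (fun _ : Ih h => 0 : 'cV[K[i]]_n).
Proof. by move=> s; apply: cst_continuous. Qed.

Definition Ccn0 : C := mkCcn Ccn0_subproof.

Lemma Ccn_opp_subproof (phi : C) : continuous (fun s => - phi s).
Proof. by move=> s; apply: continuousN; exact: Ccn_continuous. Qed.

Lemma Ccn_add_subproof (phi psi : C) : continuous (fun s => phi s + psi s).
Proof. by move=> s; apply: continuousD; exact: Ccn_continuous. Qed.

Lemma Ccn_scale_subproof (a : K[i]) (phi : C) :
  continuous (fun s => a *: phi s).
Proof.
by move=> s; apply: continuousZr; exact: Ccn_continuous.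
Qed.

Definition Ccn_opp phi : C := mkCcn (@Ccn_opp_subproof phi).
Definition Ccn_add phi psi : C := mkCcn (@Ccn_add_subproof phi psi).
Definition Ccn_scale a phi : C := mkCcn (@Ccn_scale_subproof a phi).

Fact Ccn_addA : associative Ccn_add.
Proof. by move=> f g k; apply: CcnP => s; exact: addrA. Qed.
Fact Ccn_addC : commutative Ccn_add.
Proof. by move=> f g; apply: CcnP => s; exact: addrC. Qed.
Fact Ccn_add0 : left_id Ccn0 Ccn_add.
Proof. by move=> f; apply: CcnP => s; exact: add0r. Qed.
Fact Ccn_addN : left_inverse Ccn0 Ccn_opp Ccn_add.
Proof. by move=> f; apply: CcnP => s; exact: addNr. Qed.

HB.instance Definition _ :=
  GRing.isZmodule.Build C Ccn_addA Ccn_addC Ccn_add0 Ccn_addN.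

Fact Ccn_scaleA a b (f : C) :
  Ccn_scale a (Ccn_scale b f) = Ccn_scale (a * b) f.
Proof. by apply: CcnP => s; exact: scalerA. Qed.
Fact Ccn_scale1 : left_id 1 Ccn_scale.
Proof. by move=> f; apply: CcnP => s; exact: scale1r. Qed.
Fact Ccn_scaleDr : right_distributive Ccn_scale +%R.
Proof. by move=> a f g; apply: CcnP => s; exact: scalerDr. Qed.
Fact Ccn_scaleDl (f : C) : {morph Ccn_scale^~ f : a b / a + b}.
Proof. by move=> a b; apply: CcnP => s; exact: scalerDl. Qed.

HB.instance Definition _ := GRing.Zmodule_isLmodule.Build K[i] C
  Ccn_scaleA Ccn_scale1 Ccn_scaleDr Ccn_scaleDl.

(* The supremum is a maximum: a continuous function on the compact [-h, 0]. *)
Definition Ccn_norm (N : 'cV[K[i]]_n -> K) (phi : C) : K :=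
  sup [set N (phi s) | s in [set: Ih h]].

Definition Ccn_of (f : Ih h -> 'cV[K[i]]_n) : C :=
  if pselect (continuous f) is left cf then mkCcn cf else 0.

(* v is total, but only its values on [t-h, t] are used; the segment is junk
   (zero) only when v is not continuous there. *)
Definition seg (v : K -> 'cV[K[i]]_n) (t : K) : C :=
  Ccn_of (fun s => v (t + set_val s)).

End ContinuousSegments.
Arguments seg {K} h {n} v t.

Section Equation.
Context {K : realType}.
Variables (h : K) (n : nat).
Local Notation Cn := 'cV[K[i]]_n.

(* f has derivative d at t relative to [0, +oo[: the derivative when 0 < t, the
   right derivative when t = 0. *)
Definition has_derivative_nneg (f : K -> Cn) (t : K) (d : Cn) : Prop :=
  ((s - t)^-1)%:C *: (f s - f t) @[s --> within `[0, +oo[ t^'] --> d.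

Definition is_solution (L R : Ccn h n -> Cn) (q v : K -> Cn) : Prop :=
  {within `[- h, +oo[, continuous v} /\
  forall t, 0 <= t ->
    has_derivative_nneg (fun s => v s - L (seg h v s)) t (R (seg h v t) + q t).

Definition is_solution_from (L R : Ccn h n -> Cn) (q : K -> Cn)
    (phi : Ccn h n) (v : K -> Cn) : Prop :=
  is_solution L R q v /\ seg h v 0 = phi.

(* v^phi, chosen among the functions on K that solve the homogeneous equation;
   they all agree on [-h, +oo[. *)
Definition hsol (L R : Ccn h n -> Cn) (phi : Ccn h n) : K -> Cn :=
  xget (fun=> 0) [set v | is_solution_from L R (fun=> 0) phi v].

(* S(t) phi = v^phi_t, meant for 0 <= t. *)
Definition solS (L R : Ccn h n -> Cn) (t : K) (phi : Ccn h n) : Ccn h n :=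
  seg h (hsol L R phi) t.

End Equation.

(* Main.v *)
(* The solution of the inhomogeneous equation is compared with the semigroup on
   short time steps, which replaces the variation-of-constants formula.  On
   [a, a+e] with e <= Delta, the difference z between w and the homogeneous
   solution started from w_a has zero initial segment, so that L does not see it
   and z is the integral of R z_s + q.  Hence
   (1 - |R| e) |w_{a+e} - S(e) w_a| is at most the integral of |q| on [a, a+e].
   Writing t = m e and telescoping S(t - k e) w_{k e} over k < m, the bound on
   the semigroup gives, as m goes to infinity, the claim without the factor n.
   Homogeneous solutions are built by Picard iteration in the norm
   sup |v(t)| exp (- rate t): the delay Delta makes the contribution of L
   contracting for a large rate. *)
Require Import Defs.
From mathcomp Require Import all_boot all_order all_algebra.
From mathcomp Require Import all_classical all_reals all_analysis.
From mathcomp Require Import ring lra.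
Import Order.TTheory GRing.Theory Num.Theory.
Import numFieldNormedType.Exports.
Local Open Scope classical_set_scope.
Local Open Scope ring_scope.
Local Open Scope complex_scope.

Set Implicit Arguments.
Unset Strict Implicit.
Unset Printing Implicit Defensive.

(** * Norms on C^n *)

(** [hsol] is selected by [xget], which returns 0 when no solution exists, so before existence and
    uniqueness of homogeneous solutions nothing is known about [solS], not even linearity or the
    semigroup law. This is why the homogeneous equation is solved from scratch. Variation of
    constants would in addition need a fundamental matrix, whose columns start from discontinuous
    data outside the space on which S(t) acts; with short steps every segment stays continuous.

    Integrals of vector-valued functions are never estimated as integrals. Such an integral is
    represented by a function with the prescribed derivative, and a bound by the integral of a
    scalar [g] becomes a mean value inequality against a primitive [G] of [g]. The Lebesgue integral
    only supplies scalar primitives and the final formula.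

    The norm [N] is arbitrary while the topology of column vectors is fixed by the library, so
    equivalence of norms comes first. *)

Section Norms.
Context {K : realType} {V : lmodType K[i]} (N : V -> K) (N_norm : is_norm N).
Implicit Types x y : V.

Lemma norm0 : N 0 = 0.
Proof. by rewrite -[0](scale0r 0) (is_normZ N_norm) normr0/= mul0r. Qed.

Lemma normN x : N (- x) = N x.
Proof. by rewrite -scaleN1r (is_normZ N_norm) normrN1 mul1r. Qed.

Lemma norm_ge0 x : 0 <= N x.
Proof. by have := is_normD N_norm x (- x); rewrite subrr norm0 normN; lra. Qed.

Lemma normB x y : N (x - y) <= N x + N y.
Proof. by have := is_normD N_norm x (- y); rewrite normN. Qed.

Lemma norm_distC x y : N (x - y) = N (y - x).
Proof. by rewrite -normN opprB. Qed.

Lemma norm_lipschitz x y : `|N x - N y| <= N (x - y).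
Proof.
have := is_normD N_norm (x - y) y; have := is_normD N_norm (y - x) x.
by rewrite !subrK (norm_distC y) ler_norml; lra.
Qed.

Lemma normZr (a : K) x : N (a%:C *: x) = `|a| * N x.
Proof. by rewrite (is_normZ N_norm) normc_def/= expr0n/= addr0 sqrtr_sqr. Qed.

End Norms.

Section BoundedLinear.
Context {K : realType} {V W : lmodType K[i]}.
Context (NV : V -> K) (NV_norm : is_norm NV)
  (NW : W -> K) (NW_norm : is_norm NW).

Lemma continuous_linear_bounded (T : {linear V -> W}) :
  continuous_for_norms NV NW T ->
  exists2 C, 0 < C & forall x, NW (T x) <= C * NV x.
Proof.
move=> /(_ 0 1 ltr01)[d d0 H]; exists (2 / d); first exact: divr_gt0.
move=> x; have [x0|x0] := eqVneq (NV x) 0.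
  by rewrite (is_norm_eq0 NV_norm x0) linear0 (norm0 NW_norm)
    (norm0 NV_norm) mulr0.
have Nx : 0 < NV x by rewrite lt_neqAle eq_sym x0 (norm_ge0 NV_norm).
(* Rescales [x] to norm [d / 2], inside the ball given by continuity at 0. *)
pose k := d / (2 * NV x).
have k0 : 0 < k by rewrite divr_gt0// mulr_gt0.
have /H : NV (k%:C *: x - 0) < d.
  rewrite subr0 (normZr NV_norm) gtr0_norm// /k invfM mulrA divfK//.
  by rewrite ltr_pdivrMr// ltr_pMr// ltr1n.
rewrite linear0 subr0 linearZ/= (normZr NW_norm) gtr0_norm//.
rewrite /k mulrC mulrA ltr_pdivrMr ?mulr_gt0// mul1r => H1.
by rewrite mulrAC ler_pdivlMr// ltW.
Qed.

End BoundedLinear.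

(** * Equivalence of norms on C^n *)

Section FiniteDimensionalNorms.
Context {K : realType} {n : nat}.
Local Notation Cn := 'cV[K[i]]_n.

(** An intermediary between the matrix norm, whose values lie in [K[i]], and the given norm [N]: it
    is [K]-valued and gives direct access to the 2n real coordinates. *)
Definition l1norm (x : Cn) : K :=
  \sum_j (`|complex.Re (x j 0)| + `|complex.Im (x j 0)|).

Lemma l1norm_ge0 x : 0 <= l1norm x.
Proof. by apply: sumr_ge0 => j _; rewrite addr_ge0. Qed.

Lemma Re_normc_le (z : K[i]) :
  complex.Re `|z| <= `|complex.Re z| + `|complex.Im z|.
Proof.
rewrite normc_def /=; set a := complex.Re z; set b := complex.Im z.
rewrite -[leRHS]ger0_norm ?addr_ge0// -sqrtr_sqr ler_wsqrtr//.
rewrite -(real_normK (num_real a)) -(real_normK (num_real b)).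
by rewrite sqrrD lerD2r lerDl mulrn_wge0// mulr_ge0.
Qed.

Lemma normcRe (z : K[i]) : `|z| = (complex.Re `|z|)%:C.
Proof. by rewrite normc_def. Qed.

Lemma mx_norm_le_l1norm (x : Cn) : `|x| <= (l1norm x)%:C.
Proof.
have [/(@mx_norm_eq0 _ _ _ _) ->|/mx_norm_neq0[[j k] E]] :=
  eqVneq (mx_norm x) 0.
  by rewrite normr0 lecR l1norm_ge0.
rewrite /Num.norm /= E /= (ord1 k) normcRe lecR.
apply: le_trans (Re_normc_le _) _.
by rewrite /l1norm (bigD1 j)//= lerDl sumr_ge0// => i _; rewrite addr_ge0.
Qed.

Lemma entry_le_mx_norm (x : Cn) j : `|x j 0| <= `|x|.
Proof.
rewrite [leRHS]/Num.norm /= mx_normE.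
by apply: (@le_bigmax _ _ _ 0%:nng (fun ij => `|x ij.1 ij.2|%:nng) (j, 0)).
Qed.

Lemma l1norm_lt_mx_norm (x : Cn) (e : K) : 0 < e -> `|x| < e%:C ->
  l1norm x <= n%:R * (e + e).
Proof.
move=> e0 xe; rewrite /l1norm mulrC mulr_natr -[n in leRHS]card_ord -sumr_const.
apply: ler_sum => j _.
have {}xe : `|x j 0| < e%:C := le_lt_trans (entry_le_mx_norm x j) xe.
have : `|x j 0| <= e%:C by exact: ltW.
rewrite normc_def lecR => H.
have e2 : complex.Re (x j 0) ^+ 2 + complex.Im (x j 0) ^+ 2 <= e ^+ 2.
  rewrite -[leLHS]sqr_sqrtr ?addr_ge0 ?sqr_ge0// lerXn2r// nnegrE ?sqrtr_ge0//.
  exact: ltW.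
by apply: lerD; rewrite -sqrtr_sqr -[leRHS]ger0_norm ?(ltW e0)// -sqrtr_sqr;
  apply: ler_wsqrtr; apply: le_trans e2; rewrite ?lerDl ?lerDr sqr_ge0.
Qed.

Variable N : Cn -> K.
Hypothesis N_norm : is_norm N.

Lemma norm_sum (I : finType) (F : I -> Cn) :
  N (\sum_i F i) <= \sum_i N (F i).
Proof.
elim/big_ind2 : _ => [|x a y b xa yb|//]; first by rewrite (norm0 N_norm).
by apply: le_trans (is_normD N_norm _ _) _; rewrite lerD.
Qed.

Lemma norm_le_l1norm : exists2 C, 0 < C & forall x, N x <= C * l1norm x.
Proof.
(* The summand 1 keeps the constant positive when [n = 0]. *)
pose C := 1 + \sum_(j < n) N (delta_mx j 0).
have C0 : 0 < C by rewrite ltr_pwDl// sumr_ge0// => j _;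
  exact: (norm_ge0 N_norm).
exists C => // x.
rewrite {1}(matrix_sum_delta x).
under eq_bigr do rewrite big_ord1.
apply: le_trans (norm_sum _) _.
rewrite /l1norm mulr_sumr; apply: ler_sum => j _.
rewrite (is_normZ N_norm) mulrC; apply: ler_pM => //.
- exact: (norm_ge0 N_norm).
- by have := normr_ge0 (x j 0); rewrite {1}normcRe lecR.
- rewrite /C (bigD1 j)//= [leRHS]addrCA lerDl addr_ge0// sumr_ge0// => i _.
  exact: (norm_ge0 N_norm).
- exact: Re_normc_le.
Qed.

(* By compactness of the unit sphere of K^(2n). *)
Lemma l1norm_le_norm : exists2 C, 0 < C & forall x, l1norm x <= C * N x.
Proof.
pose f (r : 'rV[K]_(n + n)) : Cn :=
  \col_j (r 0 (lshift n j) +i* r 0 (rshift n j)).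
have fB r s : f r - f s = f (r - s).
  by apply/matrixP => j k; rewrite !mxE; apply/eqP; rewrite eq_complex/= !eqxx.
have fZ a r : f (a *: r) = a%:C *: f r.
  apply/matrixP => j k; rewrite !mxE; apply/eqP; rewrite eq_complex/=.
  by rewrite !mul0r subr0 addr0 !eqxx.
have le_r (r : 'rV[K]_(n + n)) j : `|r 0 j| <= `|r|.
  rewrite [leRHS]/Num.norm /= mx_normE.
  exact: (@le_bigmax _ _ _ 0%:nng (fun ij => `|r ij.1 ij.2|%:nng) (0, j)).
have lf r : l1norm (f r) <= n%:R * (`|r| + `|r|).
  have -> : n%:R * (`|r| + `|r|) = \sum_(j < n) (`|r| + `|r|).
    by rewrite sumr_const card_ord mulr_natl.
  by apply: ler_sum => j _; rewrite !mxE/= lerD.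
have [C1 C1gt0 NC1] := norm_le_l1norm.
pose g r := N (f r).
have cg : continuous g.
  move=> r; apply/(@cvgrPdist_lt _ _ _ (nbhs r) (nbhs_filter r)) => e e0.
  have B : 0 < C1 * (n%:R + n%:R) + 1.
    by rewrite ltr_wpDl// mulr_ge0 ?(ltW C1gt0)// addr_ge0.
  near=> s.
  apply: le_lt_trans (norm_lipschitz N_norm _ _) _; rewrite fB.
  apply: le_lt_trans (NC1 _) _.
  apply: (@le_lt_trans _ _ ((C1 * (n%:R + n%:R) + 1) * `|r - s|)).
    rewrite mulrDl mul1r -mulrA -[leLHS]addr0 lerD//.
    by rewrite ler_pM2l// (le_trans (lf _))// mulrDl mulrDr.
  rewrite mulrC -ltr_pdivlMr//; near: s.
  by apply: (@cvgr_dist_lt _ _ _ (nbhs r) _ (fun s => s)) => //;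
    rewrite divr_gt0.
have gS r : `|r| = 1 -> g r != 0.
  move=> r1; apply/eqP => /(is_norm_eq0 N_norm) fr0.
  have : r = 0.
    apply/matrixP => k j; rewrite (ord1 k) mxE -(fintype.splitK j).
    have fr k' : (f r) k' 0 = 0 by rewrite fr0 mxE.
    by case: (fintype.split j) => k' /=; have := fr k'; rewrite mxE => /eqP;
      rewrite eq_complex/= => /andP[/eqP ? /eqP ?].
  by move=> r0; move: r1; rewrite r0 normr0 => /esym/eqP; rewrite oner_eq0.
pose S := [set r : 'rV[K]_(n + n) | `|r| = 1].
have cS : compact S.
  apply: bounded_closed_compact.
    exists 1; split => // M M1 r /= ->; exact: ltW.
  have -> : S = (fun r => `|r|) @^-1` [set 1] by [].
  apply: (@preimage_closed _ _ _ [set (1 : K)]); last exact: closed_eq.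
  by move=> r _; exact: norm_continuous.
(* Bounding [1 / g] on the sphere, instead of minimising [g], also covers the empty sphere of the
   case [n = 0]. *)
have : compact [set (g r)^-1 | r in S].
  apply: continuous_compact cS; apply: continuous_in_subspaceT => r.
  by rewrite inE => /gS gr; apply: continuousV => //; exact: cg.
move=> /compact_bounded[M [_ HM]].
pose C := Num.max 1 (M + 1).
have Cgt0 : 0 < C by rewrite lt_max ltr01.
have CP r : `|r| <= C * g r.
  have [->|r0] := eqVneq r 0;
    first by rewrite normr0 mulr_ge0 ?(ltW Cgt0)//; exact: (norm_ge0 N_norm).
  have nr : 0 < `|r| by rewrite normr_gt0.
  have S1 : S (`|r|^-1 *: r).
    by rewrite /S/= normrZ normfV normr_id mulVf// gt_eqF.
  have /HM : M < C by rewrite lt_max ltrDl ltr01 orbT.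
  move=> /(_ _ (ex_intro2 _ _ _ S1 erefl)) /= H.
  have gZ : g (`|r|^-1 *: r) = `|r|^-1 * g r.
    by rewrite /g fZ (normZr N_norm) ger0_norm// invr_ge0.
  have g0 : 0 < g r.
    rewrite lt_neqAle [0 <= _](norm_ge0 N_norm) andbT eq_sym.
    by apply: contra (gS _ S1) => /eqP g0; rewrite gZ g0 mulr0.
  by move: H; rewrite gZ invfM invrK ger0_norm ?ler_pdivrMr// divr_ge0 ?ltW.
exists (n%:R * (C + C) + 1).
  by rewrite ltr_wpDl// mulr_ge0// addr_ge0// ltW.
move=> x; pose r : 'rV[K]_(n + n) := row_mx
  (\row_j complex.Re (x j 0)) (\row_j complex.Im (x j 0)).
have <- : f r = x.
  apply/matrixP => j k; rewrite !mxE (ord1 k).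
  by rewrite (unsplitK (inl j)) (unsplitK (inr j)) !mxE; case: (x j 0).
apply: le_trans (lf r) _;
  rewrite mulrDl mul1r -[leLHS]addr0 lerD ?(norm_ge0 N_norm)//.
by rewrite -mulrA ler_wpM2l// mulrDl lerD// CP.
Unshelve. all: by end_near. Qed.

(** Both comparisons with [l1norm] are used, one for each direction. From here on, limits in C^n are
    tested with [N]. *)
Lemma cvg_normP {T} (F : set_system T) {FF : Filter F} (f : T -> Cn) (l : Cn) :
  f x @[x --> F] --> l <->
  (forall e, 0 < e -> \forall x \near F, N (f x - l) < e).
Proof.
split=> [/cvgrPdist_lt fl e e0|fl].
  have [C C0 NC] := norm_le_l1norm.
  have B : 0 < C * (n%:R + n%:R) + 1.
    by rewrite ltr_wpDl// mulr_ge0 ?(ltW C0)// addr_ge0.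
  pose d := e / (C * (n%:R + n%:R) + 1).
  have d0 : 0 < d by rewrite divr_gt0.
  have /fl : (0 : K[i]) < d%:C by rewrite ltcR.
  apply: filterS => x /(l1norm_lt_mx_norm d0) H.
  rewrite (norm_distC N_norm) (le_lt_trans (NC _))//.
  apply: le_lt_trans (ler_wpM2l (ltW C0) H) _.
  have -> : e = d * (C * (n%:R + n%:R) + 1) by rewrite divfK// gt_eqF.
  by nra.
(* In the order of [K[i]], [0 < e] forces the imaginary part to vanish, so [e] can be replaced by
   its real part. *)
apply/cvgrPdist_lt => e; rewrite ltcE/= => /andP[/eqP e0 ep].
have [C C0 NC] := l1norm_le_norm.
have /fl : 0 < complex.Re e / C by rewrite divr_gt0.
apply: filterS => x H; apply: le_lt_trans (mx_norm_le_l1norm _) _.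
have -> : e = (complex.Re e)%:C by apply/eqP; rewrite eq_complex/= e0 !eqxx.
rewrite ltcR (le_lt_trans (NC _))// (norm_distC N_norm) mulrC -ltr_pdivlMr//.
Qed.

Lemma norm_continuousP {T : topologicalType} (f : T -> Cn) :
  continuous f <->
  (forall t e, 0 < e -> \forall x \near t, N (f x - f t) < e).
Proof. by split=> cf t; [move/cvg_normP: (cf t)|apply/cvg_normP/cf]. Qed.

Lemma continuous_norm {T : topologicalType} (f : T -> Cn) t :
  {for t, continuous f} -> {for t, continuous (fun x => N (f x))}.
Proof.
move=> /cvg_normP cf; apply/cvgrPdist_lt => e e0.
move: (cf _ e0); apply: filterS => x; apply: le_lt_trans.
by rewrite distrC; exact: (norm_lipschitz N_norm).
Qed.

End FiniteDimensionalNorms.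

(** * Mean value inequality and primitives *)

Section RealAnalysis.
Context {K : realType}.
Implicit Types (F G : K -> K) (a b t : K).

Lemma near_derive (F : K -> K) t d : is_derive t 1 F d ->
  forall e, 0 < e ->
    \forall s \near t, `|F s - F t - (s - t) * d| <= e * `|s - t|.
Proof.
move=> [dF Fd] e e0.
have : (fun k => k^-1 *: (F (k *: 1 + t) - F t)) @ 0^' --> d.
  by rewrite -Fd; exact: dF.
move=> /cvgrPdist_le /(_ _ e0).
rewrite near_withinE => H.
rewrite (near_shift 0 t)/= subr0; near=> s.
have [->|s0] := eqVneq s 0;
  first by rewrite /= add0r !subrr mul0r subrr !normr0 mulr0.
rewrite /= addrK.
have : `|d - s^-1 *: (F (s *: 1 + t) - F t)| <= e by move: s0; near: s.
rewrite /GRing.scale/= mulr1 => H2.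
have -> : F (s + t) - F t - s * d = - s * (d - s^-1 * (F (s + t) - F t)).
  by rewrite mulrBr mulNr mulNr mulVKf//; ring.
by rewrite normrM normrN mulrC ler_wpM2r.
Unshelve. all: by end_near. Qed.

Lemma is_derive_continuous (F : K -> K) t d :
  is_derive t 1 F d -> {for t, continuous F}.
Proof. by move=> [/derivable1_diffP/differentiable_continuous]. Qed.

(** Continuous induction: let [m] be the supremum of the times up to which [f] stays nonpositive.
    Continuity gives [f m <= 0], and the step hypothesis then passes beyond [m] unless [m = b]. *)
Lemma le0_propagation (f : K -> K) a b : a <= b ->
  (forall t, a <= t <= b -> {for t, continuous f}) -> f a <= 0 ->
  (forall t, a <= t < b -> f t <= 0 ->
     exists2 d, 0 < d & forall u, t < u < t + d -> f u <= 0) ->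
  f b <= 0.
Proof.
move=> ab cf fa step.
pose S := [set t | a <= t <= b /\ forall u, a <= u <= t -> f u <= 0].
have Sa : S a.
  split; first by rewrite lexx.
  by move=> u /andP[au ua]; rewrite (_ : u = a)//; apply/eqP; rewrite eq_le ua.
have hS : has_sup S by split; [exists a|exists b => t [/andP[]]].
pose m := sup S.
have am : a <= m by exact: ub_le_sup hS.2 _ Sa.
have mb : m <= b by apply: ge_sup hS.1 _ => t [/andP[]].
have below u : a <= u -> u < m -> f u <= 0.
  move=> au um; have [t [_ ft] ut] := sup_gt hS.1 um.
  by apply: ft; rewrite au ltW.
have fm : f m <= 0.
  rewrite leNgt; apply/negP => fm.
  have [am'|] := ltP a m; last first.
    by move=> ma; move: fm; rewrite (_ : m = a) ?ltNge ?fa//;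
      apply/eqP; rewrite eq_le am ma.
  have /cvgrPdist_lt /(_ _ fm) : {for m, continuous f}
    by apply: cf; rewrite am mb.
  move=> /nbhs_ballP[d /= d0 H].
  pose u := Num.max a (m - d / 2).
  have um : u < m by rewrite gt_max am'/=; lra.
  have : f u <= 0 by apply: below; rewrite ?le_max ?lexx.
  have : m - d / 2 <= u by rewrite le_max lexx orbT.
  have /H /= : ball m d u.
    rewrite /ball/= ger0_norm ?subr_ge0 ?ltW//.
    by rewrite ltrBlDr -ltrBlDl lt_max; apply/orP; right; lra.
  by rewrite ltr_norml; lra.
have Sm u : a <= u <= m -> f u <= 0.
  by case/andP => au; rewrite le_eqVlt => /predU1P[->//|]; exact: below.
have [/eqP <-//|mb'] : m == b \/ m < b by rewrite le_eqVlt in mb; exact/orP.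
have [|d d0 Hd] := step m _ fm; first by rewrite am.
pose v := Num.min (m + d / 2) b.
have mv : m < v by rewrite lt_min mb' andbT; lra.
have : S v.
  split; first by rewrite (le_trans am (ltW mv))/= ge_min lexx orbT.
  move=> u /andP[au uv]; have [um|um] := leP u m;
    first by apply: Sm; rewrite au.
  apply: Hd; rewrite um/= (le_lt_trans uv)// gt_min; apply/orP; left; lra.
by move=> /(ub_le_sup hS.2); rewrite -/m leNgt mv.
Qed.

Lemma continuous_primitive (f : K -> K) : continuous f ->
  exists F : K -> K, forall t, 0 <= t -> is_derive t 1 F (f t).
Proof.
move=> cf.
(* Starting at -1 makes every [t >= 0] interior, so that the derivative at 0 is two-sided. *)
exists (fun x => \int[lebesgue_measure]_(t in `[(-1)%R, x]) f t) => t t0.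
have [||||dF F'] := @continuous_FTC1_closed K f (-1) t (t + 1).
- by rewrite ltrDl.
- apply: continuous_compact_integrable; first exact: segment_compact.
  exact: continuous_subspaceT.
- by rewrite (lt_le_trans _ t0)// ltrN10.
- exact: cf.
by split; [exact: dF|rewrite -derive1E F'].
Qed.

End RealAnalysis.

Section VectorValued.
Context {K : realType} {n : nat}.
Local Notation Cn := 'cV[K[i]]_n.
Context (N : Cn -> K) (N_norm : is_norm N).
Implicit Types (a b t s : K).

(** Multiplying the difference quotient by [s - t] makes the condition trivial at [s = t]: the
    punctured neighbourhood disappears and later arguments need no division. *)
Lemma has_derivative_nnegP (f : K -> Cn) t d :
  has_derivative_nneg f t d <->
  forall e, 0 < e -> \forall s \near t, 0 <= s ->
    N (f s - f t - (s - t)%:C *: d) <= e * `|s - t|.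
Proof.
have E s : s != t ->
    f s - f t - (s - t)%:C *: d =
    (s - t)%:C *: (((s - t)^-1)%:C *: (f s - f t) - d).
  move=> st; rewrite scalerBr scalerA -rmorphM/= divff ?subr_eq0//.
  by rewrite scale1r.
rewrite /has_derivative_nneg; split=> [/(cvg_normP N_norm) H e e0|H].
  move: (H _ e0); rewrite near_withinE near_withinE.
  apply: filterS => s Hs s0.
  have [->|st] := eqVneq s t;
    first by rewrite !subrr scale0r subrr (norm0 N_norm)// normr0 mulr0.
  rewrite E// (normZr N_norm)// mulrC ler_wpM2r// ltW// Hs//=.
  by rewrite in_itv/= s0.
apply/(cvg_normP N_norm) => e e0; rewrite near_withinE near_withinE.
have /H : 0 < e / 2 by rewrite divr_gt0.
apply: filterS => s Hs st; rewrite /= in_itv/= andbT => /Hs.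
rewrite E// (normZr N_norm)// mulrC ler_pM2r ?normr_gt0 ?subr_eq0//.
by move/le_lt_trans; apply; lra.
Qed.

(** Replaces the bound of a vector integral by the integral of a majorant of the norm. The
    propagation only looks to the right of each point, so the one-sided derivative at 0 suffices. *)
Lemma norm_mean_value (f f' : K -> Cn) (G g : K -> K) a b : 0 <= a -> a <= b ->
  continuous f -> (forall t, a <= t <= b -> is_derive t 1 G (g t)) ->
  (forall t, a <= t <= b -> has_derivative_nneg f t (f' t)) ->
  (forall t, a <= t <= b -> N (f' t) <= g t) ->
  N (f b - f a) <= G b - G a.
Proof.
move=> a0 ab cf dG df fg.
suff H e : 0 < e -> N (f b - f a) - (G b - G a) - e * (b - a) <= 0.
  rewrite -subr_le0; apply/ler_addgt0Pr => e e0; rewrite add0r.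
  have ba1 : 0 < b - a + 1 by rewrite ltr_wpDl// subr_ge0.
  have := H (e / (b - a + 1)) (divr_gt0 e0 ba1).
  rewrite subr_le0 => /le_trans; apply.
  by rewrite -mulrA ler_piMr ?(ltW e0)// mulrC ler_pdivrMr// mul1r; lra.
move=> e0.
(* The slack [e * (t - a)] absorbs the first-order errors of [f] and of [G], each taken with
   [e / 2]; hence just to the right of [t] the function [p] does not exceed [p t]. *)
pose p t := N (f t - f a) - (G t - G a) - e * (t - a).
apply: (@le0_propagation _ p a b) => //.
- move=> t tab; apply: continuousB.
    apply: continuousB.
      apply: (@continuous_norm _ _ _ N_norm _ (fun x => f x - f a)).
      by apply: continuousB; [exact: cf|exact: cst_continuous].
    apply: continuousB; last exact: cst_continuous.
    exact: is_derive_continuous (dG _ tab).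
  apply: (@continuousM _ _ (cst e) (fun x => x - a));
    first exact: cst_continuous.
  by apply: continuousB; [exact: cvg_id|exact: cst_continuous].
- by rewrite /p !subrr (norm0 N_norm)// mulr0 !subr0.
move=> t /andP[at_ tb] pt0.
have tab : a <= t <= b by rewrite at_ ltW.
have e20 : 0 < e / 2 by rewrite divr_gt0.
have := (has_derivative_nnegP _ _ _).1 (df _ tab) _ e20.
have := near_derive (dG _ tab) e20.
move=> H1 H2; have [d /= d0 H] := (nbhs_ballP _ _).1 (filterI H1 H2).
exists d => // u /andP[tu utd]; apply: le_trans pt0.
have /H[] : ball t d u by rewrite /ball/= distrC gtr0_norm; lra.
have u0 : 0 <= u by lra.
rewrite [`|u - t|]gtr0_norm ?subr_gt0// => + /(_ u0).
rewrite ler_norml => /andP[Gu _] fu.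
have ut0 : 0 <= u - t by lra.
have : N ((u - t)%:C *: f' t) <= (u - t) * g t.
  by rewrite (normZr N_norm)// ger0_norm// ler_wpM2l// fg.
have := is_normD N_norm (f u - f t - (u - t)%:C *: f' t) ((u - t)%:C *: f' t).
rewrite subrK; have := is_normD N_norm (f u - f t) (f t - f a).
rewrite addrA subrK /p.
by nra.
Qed.

Lemma continuous_entry (f : K -> Cn) (j : 'I_n) : continuous f ->
  continuous (fun t => complex.Re (f t j 0)) /\
  continuous (fun t => complex.Im (f t j 0)).
Proof.
move=> cf; have [C C0 lC] := l1norm_le_norm N_norm.
have H t e : 0 < e -> \forall x \near t, l1norm (f x - f t) < e.
  move=> e0; have H := (norm_continuousP N_norm f).1 cf t.
  have /H : 0 < e / C by rewrite divr_gt0.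
  by apply: filterS => x; rewrite ltr_pdivlMr// mulrC; exact: le_lt_trans.
have le_l1 (x : Cn) :
    `|complex.Re (x j 0)| + `|complex.Im (x j 0)| <= l1norm x.
  by rewrite /l1norm (bigD1 j)//= lerDl sumr_ge0// => k _; rewrite addr_ge0.
split=> t; apply/cvgrPdist_lt => e /(H t); apply: filterS => x;
  apply: le_lt_trans; apply: le_trans (le_l1 _); rewrite !mxE distrC;
  case: (f x j 0) (f t j 0) => [x1 x2] [y1 y2] /=.
- by rewrite lerDl.
- by rewrite lerDr.
Qed.

Lemma vector_primitive (f : K -> Cn) : continuous f ->
  exists F : K -> Cn, [/\ continuous F, F 0 = 0 &
    forall t, 0 <= t -> has_derivative_nneg F t (f t)].
Proof.
move=> cf.
have /choice[A HA] j := continuous_primitive (continuous_entry j cf).1.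
have /choice[B HB] j := continuous_primitive (continuous_entry j cf).2.
pose F0 t : Cn := \col_j (A j t +i* B j t).
have [C C0 NC] := norm_le_l1norm N_norm.
have dF0 t e : 0 <= t -> 0 < e ->
    \forall s \near t, N (F0 s - F0 t - (s - t)%:C *: f t) <= e * `|s - t|.
  move=> t0 e0.
  pose d := e / (C * (n%:R * 2) + 1).
  have B0 : 0 < C * (n%:R * 2) + 1 by rewrite ltr_wpDl// !mulr_ge0// ltW.
  have d0 : 0 < d by rewrite divr_gt0.
  have H1 : \forall s \near t, forall j : 'I_n,
      `|A j s - A j t - (s - t) * complex.Re (f t j 0)| <= d * `|s - t|.
    by apply: (filter_forall (nbhs_filter t)) => j;
      exact: near_derive (HA j t t0) _ d0.
  have H2 : \forall s \near t, forall j : 'I_n,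
      `|B j s - B j t - (s - t) * complex.Im (f t j 0)| <= d * `|s - t|.
    by apply: (filter_forall (nbhs_filter t)) => j;
      exact: near_derive (HB j t t0) _ d0.
  apply: filterS (filterI H1 H2) => s [{}H1 {}H2].
  apply: le_trans (NC _) _.
  apply: (@le_trans _ _ (C * (n%:R * (d * `|s - t| + d * `|s - t|)))).
    rewrite ler_wpM2l ?(ltW C0)//.
    have -> : n%:R * (d * `|s - t| + d * `|s - t|) =
        \sum_(j < n) (d * `|s - t| + d * `|s - t|).
      by rewrite sumr_const card_ord mulr_natl.
    apply: ler_sum => j _; rewrite !mxE.
    have := H1 j; have := H2 j; case: (f t j 0) => x y /=.
    by rewrite !mul0r subr0 addr0 => ? ?; rewrite lerD.
  have -> : e = d * (C * (n%:R * 2) + 1) by rewrite divfK// gt_eqF.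
  have := mulr_ge0 (ltW d0) (normr_ge0 (s - t)); lra.
have cF0 t : 0 <= t -> {for t, continuous F0}.
  move=> t0; apply/(cvg_normP N_norm) => e e0.
  pose M := N (f t) + 1.
  have M0 : 0 < M by rewrite ltr_wpDl// (norm_ge0 N_norm).
  have H : \forall s \near t, `|t - s| < e / M.
    by apply: (@cvgr_dist_lt _ _ _ (nbhs t) _ (fun s => s)) => //;
      rewrite divr_gt0.
  apply: filterS (filterI (dF0 t 1 t0 ltr01) H) => s [H1 H2].
  have := is_normD N_norm (F0 s - F0 t - (s - t)%:C *: f t) ((s - t)%:C *: f t).
  rewrite subrK (normZr N_norm)// => /le_lt_trans; apply.
  move: H2; rewrite ltr_pdivlMr// distrC => /(le_lt_trans _); apply.
  by rewrite /M; lra.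
(* [F0] is controlled only on [t >= 0]. Freezing it for negative times gives continuity on the whole
   line and leaves [has_derivative_nneg] unaffected. *)
exists (fun t => F0 (Num.max t 0) - F0 0); split.
- move=> t.
  apply: (@continuousB _ _ _ (fun t => F0 (Num.max t 0)) (cst (F0 0)));
    last exact: cst_continuous.
  apply: (@continuous_comp _ _ _ (fun t => Num.max t 0) F0).
    apply: (@continuous_max _ _ (fun x : K => x) (cst 0)); first exact: cvg_id.
    exact: cst_continuous.
  by apply: cF0; rewrite le_max lexx orbT.
- by rewrite maxxx subrr.
move=> t t0; apply/has_derivative_nnegP => e e0.
move: (dF0 t e t0 e0); apply: filterS => s + s0.
by rewrite !max_l// opprB addrA subrK.
Qed.

End VectorValued.

(** * Segments *)

Section Segments.
Context {K : realType} (h : K) {n : nat}.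
Local Notation Cn := 'cV[K[i]]_n.
Local Notation C := (Ccn h n).
Local Notation V := (@set_val _ `[- h, 0]%classic).
Hypothesis h_ge0 : 0 <= h.
Implicit Types (s : Ih h) (t : K).

Lemma Ih_itv s : - h <= V s <= 0.
Proof. by case: s => x /= /[dup] /set_mem; rewrite /= in_itv. Qed.

(** The retraction of the line onto [-h, 0]. Composition with it turns a map on the subtype [Ih h]
    into a map on [K], to which results on real intervals apply. *)
Definition clamp t : Ih h.
Proof.
exists (Num.min (Num.max t (- h)) 0).
by apply/mem_set; rewrite /= in_itv/= le_min le_max lexx oppr_le0 h_ge0 orbT
  ge_min lexx orbT.
Defined.

Lemma set_val_clamp t : - h <= t <= 0 -> V (clamp t) = t.
Proof. by move=> /andP[ht t0]; rewrite /set_val/= max_l// min_l. Qed.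

Lemma clampK s : clamp (V s) = s.
Proof. by apply: val_inj; exact/set_val_clamp/Ih_itv. Qed.

Lemma clamp_continuous : continuous clamp.
Proof.
apply: continuous_comp_initial => t /=.
apply: (@continuous_min _ _ (fun x : K => Num.max x (- h)) (cst 0)).
  apply: (@continuous_max _ _ (fun x : K => x) (cst (- h)));
    first exact: cvg_id.
  exact: cst_continuous.
exact: cst_continuous.
Qed.

Lemma set_val_continuous : continuous (V : Ih h -> K).
Proof. exact: initial_continuous. Qed.

Lemma segE (v : K -> Cn) t s : continuous v -> seg h v t s = v (t + V s).
Proof.
move=> cv; rewrite /seg /Ccn_of; case: pselect => // -[] u.
apply: (@continuous_comp _ _ _ (fun s => t + V s) v); last exact: cv.
by apply: continuousD; [exact: cst_continuous|exact: set_val_continuous].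
Qed.

Lemma seg_ext (v w : K -> Cn) t :
  (forall s : K, t - h <= s <= t -> v s = w s) -> seg h v t = seg h w t.
Proof.
move=> vw; rewrite /seg; congr Ccn_of; apply/funext => s; apply: vw.
by have := Ih_itv s; lra.
Qed.

Lemma seg_shift (v : K -> Cn) (a t : K) :
  seg h (fun x => v (x + a)) t = seg h v (t + a).
Proof.
by rewrite /seg; congr Ccn_of; apply/funext => s; rewrite addrAC.
Qed.

Lemma Ccn_extension_continuous (phi : C) : continuous (fun t => phi (clamp t)).
Proof.
move=> t; apply: (@continuous_comp _ _ _ clamp phi);
  first exact: clamp_continuous.
exact: Ccn_continuous.
Qed.

Lemma seg_extension (phi : C) : seg h (fun t => phi (clamp t)) 0 = phi.
Proof.
apply: CcnP => s; rewrite (segE 0 s (@Ccn_extension_continuous phi)).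
by rewrite add0r clampK.
Qed.

Lemma CcnBE (phi psi : C) s : (phi - psi) s = phi s - psi s.
Proof. reflexivity. Qed.

Lemma CcnZE a (phi : C) s : (a *: phi) s = a *: phi s.
Proof. reflexivity. Qed.

Lemma segZ a (v : K -> Cn) t : continuous v ->
  seg h (fun x => a *: v x) t = a *: seg h v t.
Proof.
move=> cv.
have cav : continuous (fun x => a *: v x).
  by move=> x; apply: continuousZr; exact: cv.
apply: CcnP => s; rewrite (segE t s cav).
by rewrite (CcnZE a (seg h v t)); congr (_ *: _); exact: esym (segE t s cv).
Qed.

Lemma segB (v w : K -> Cn) t : continuous v -> continuous w ->
  seg h (fun x => v x - w x) t = seg h v t - seg h w t.
Proof.
move=> cv cw.
have cvw : continuous (fun x => v x - w x).
  by move=> x; apply: continuousB; [exact: cv|exact: cw].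
apply: CcnP => s; rewrite (segE t s cvw).
rewrite (CcnBE (seg h v t)); congr (_ - _).
  exact: esym (segE t s cv).
exact: esym (segE t s cw).
Qed.

Context (N : Cn -> K) (N_norm : is_norm N).

Lemma Ccn_norm_attained (phi : C) :
  exists r, forall s, N (phi s) <= N (phi r).
Proof.
have cN : continuous (fun t => N (phi (clamp t))).
  move=> t; apply: (@continuous_norm _ _ _ N_norm _ (fun t => phi (clamp t))).
  exact: Ccn_extension_continuous.
have hh : - h <= 0 by rewrite oppr_le0.
have [c _ Hc] := EVT_max hh (continuous_subspaceT cN).
by exists (clamp c) => s; rewrite -(clampK s); apply: Hc;
  rewrite in_itv/= Ih_itv.
Qed.

Lemma norm_le_Ccn_norm (phi : C) s : N (phi s) <= Ccn_norm N phi.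
Proof.
have [r Hr] := Ccn_norm_attained phi.
by apply: ub_le_sup; [exists (N (phi r)) => _ [x _ <-]; exact: Hr|exists s].
Qed.

Lemma Ccn_norm_le (phi : C) M :
  (forall s, N (phi s) <= M) -> Ccn_norm N phi <= M.
Proof.
move=> H; apply: ge_sup; first by exists (N (phi (clamp 0))), (clamp 0).
by move=> _ [s _ <-].
Qed.

Lemma Ccn_norm_lt (phi : C) M :
  (forall s, N (phi s) < M) -> Ccn_norm N phi < M.
Proof.
have [r Hr] := Ccn_norm_attained phi.
by move=> H; apply: le_lt_trans (H r); exact: Ccn_norm_le.
Qed.

Lemma Ccn_norm_is_norm : is_norm (Ccn_norm N : C -> K).
Proof.
split=> [phi phi0|a phi|phi psi].
- apply: CcnP => s; apply: (is_norm_eq0 N_norm); apply/eqP.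
  by rewrite eq_le (norm_ge0 N_norm) -phi0 norm_le_Ccn_norm.
- have a0 : 0 <= complex.Re `|a| by rewrite normc_def sqrtr_ge0.
  have le b (chi : C) :
      Ccn_norm N (b *: chi) <= complex.Re `|b| * Ccn_norm N chi.
    apply: Ccn_norm_le => s; rewrite (is_normZ N_norm).
    by rewrite ler_wpM2l ?norm_le_Ccn_norm// normc_def sqrtr_ge0.
  apply/eqP; rewrite eq_le le andTb.
  have [->|aN0] := eqVneq a 0.
    rewrite normr0/= mul0r; apply: le_trans (norm_le_Ccn_norm _ (clamp 0)).
    exact: norm_ge0.
  have := le a^-1 (a *: phi); rewrite scalerA mulVf// scale1r.
  have -> : complex.Re `|a^-1| = (complex.Re `|a|)^-1.
    by rewrite normrV ?unitfE// normc_def -fmorphV.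
  have a1 : 0 < complex.Re `|a|.
    by rewrite -ltcR -normcRe normr_gt0.
  by rewrite mulrC ler_pdivlMr// mulrC.
- apply: Ccn_norm_le => s; apply: le_trans (is_normD N_norm _ _) _.
  by rewrite lerD// norm_le_Ccn_norm.
Qed.

(** This is uniform continuity of [v] near the compact interval [t-h, t]: the estimate is proved
    locally in [u] and [s] at once, and compactness of [-h, 0] makes it uniform in [u]. *)
Lemma seg_continuous (v : K -> Cn) t e : continuous v -> 0 < e ->
  \forall s \near t, Ccn_norm N (seg h v s - seg h v t) < e.
Proof.
move=> cv e0.
have H (u : K) : `[- h, 0]%classic u -> \forall u' \near u & s \near t,
    N (v (s + u') - v (t + u')) < e.
  move=> _.
  have e2 : 0 < e / 2 by rewrite divr_gt0.
  have H1 : \forall p \near (u, t), N (v (p.2 + p.1) - v (t + u)) < e / 2.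
    have : {for (u, t), continuous (fun p : K * K => v (p.2 + p.1))}.
      apply: (@continuous_comp _ _ _ (fun p : K * K => p.2 + p.1) v).
        by apply: cvgD; [exact: cvg_snd|exact: cvg_fst].
      exact: cv.
    by move=> /(cvg_normP N_norm); exact.
  have H2 : \forall p \near (u, t), N (v (t + p.1) - v (t + u)) < e / 2.
    have : {for (u, t), continuous (fun p : K * K => v (t + p.1))}.
      apply: (@continuous_comp _ _ _ (fun p : K * K => t + p.1) v).
        by apply: cvgD; [exact: cvg_cst|exact: cvg_fst].
      exact: cv.
    by move=> /(cvg_normP N_norm); exact.
  apply: filterS (filterI H1 H2) => -[u' s] /= [{}H1 {}H2].
  have := normB N_norm (v (s + u') - v (t + u)) (v (t + u') - v (t + u)).
  by rewrite opprB addrA subrK; lra.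
have := (compact_near_coveringP _).1 (@segment_compact K (- h) 0).
move=> /(_ K (nbhs t) (fun r u => N (v (r + u) - v (t + u)) < e) _ H).
apply: filterS => s Hs; apply: Ccn_norm_lt => x /=.
have -> : (seg h v s - seg h v t) x = v (s + V x) - v (t + V x).
  rewrite (CcnBE (seg h v s)); congr (_ - _); exact: segE.
by apply: Hs; rewrite /= in_itv/= Ih_itv.
Qed.

Lemma continuous_linear_seg (T : {linear C -> Cn}) (v : K -> Cn) :
  continuous_for_norms (Ccn_norm N) N T -> continuous v ->
  continuous (fun t => T (seg h v t)).
Proof.
move=> cT cv; apply/(norm_continuousP N_norm) => t e e0.
have [B B0 TB] := continuous_linear_bounded Ccn_norm_is_norm N_norm cT.
have := seg_continuous t cv (divr_gt0 e0 B0); apply: filterS => s H.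
by rewrite -linearB (le_lt_trans (TB _))// mulrC -ltr_pdivlMr.
Qed.

(** [T] takes the same value at [phi] and at its modification that is constant to the right of
    [- Delta], and the norm of the latter only involves [phi] on [-h, -Delta]. This is the
    quantitative form of the delay condition. *)
Lemma delayed_linear_bounded (T : {linear C -> Cn}) (Delta : K) :
  continuous_for_norms (Ccn_norm N) N T -> Delta <= h ->
  (forall phi : C, (forall s, V s <= - Delta -> phi s = 0) -> T phi = 0) ->
  exists2 B, 0 < B & forall (phi : C) M,
    (forall s, V s <= - Delta -> N (phi s) <= M) -> N (T phi) <= B * M.
Proof.
move=> cT Dh TD.
have [B B0 TB] := continuous_linear_bounded Ccn_norm_is_norm N_norm cT.
exists B => // phi M phiM.
pose r (s : Ih h) := clamp (Num.min (V s) (- Delta)).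
have Vr s : V (r s) = Num.min (V s) (- Delta).
  have /andP[hs s0] := Ih_itv s.
  by rewrite set_val_clamp// le_min hs lerN2 Dh ge_min s0.
have cr : continuous (fun s => phi (r s)).
  move=> s; apply: (@continuous_comp _ _ _ r phi); last exact: Ccn_continuous.
  apply: (@continuous_comp _ _ _
    (fun s : Ih h => Num.min (V s) (- Delta)) clamp);
    last exact: clamp_continuous.
  apply: (@continuous_min _ _ (V : Ih h -> K) (cst (- Delta))).
    exact: set_val_continuous.
  exact: cst_continuous.
have -> : T phi = T (mkCcn cr).
  apply/eqP; rewrite -subr_eq0 -linearB; apply/eqP/TD => s sD.
  rewrite (CcnBE phi) -[mkCcn cr s]/(phi (r s)).
  have -> : r s = s by rewrite /r min_l// clampK.
  by rewrite subrr.
apply: le_trans (TB _) _; rewrite ler_pM2l//; apply: Ccn_norm_le => s /=.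
by apply: phiM; rewrite Vr ge_min lexx orbT.
Qed.

End Segments.

Lemma continuous_within_max {K : realType} {T : topologicalType} (a : K)
    (v : K -> T) :
  {within `[a, +oo[, continuous v} -> continuous (fun t => v (Num.max t a)).
Proof.
move=> /subspace_continuousP cv t U.
have am : a <= Num.max t a by rewrite le_max lexx orbT.
have cm : {for t, continuous (fun t => Num.max t a)}.
  apply: (@continuous_max _ _ (fun x : K => x) (cst a)); first exact: cvg_id.
  exact: cst_continuous.
have /cv H : `[a, +oo[%classic (Num.max t a) by rewrite /= in_itv/= am.
move=> /H/cm HU; apply: (filterS (F := nbhs t) _ HU) => s /=; apply.
by rewrite /= in_itv/= andbT le_max lexx orbT.
Qed.

(** * Solutions and uniqueness *)

(* Unifying two segments by unfolding Ccn_of and sup does not terminate in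
   practice. *)
Local Opaque seg Ccn_norm.

(** * Rules for the derivative relative to [0, +oo[ *)

Section DerivativeCalculus.
Context {K : realType} {n : nat}.
Local Notation Cn := 'cV[K[i]]_n.
Context (N : Cn -> K) (N_norm : is_norm N).
Implicit Types (f g : K -> Cn) (t a : K) (c d : Cn).

Lemma has_derivative_nneg_ext f g c t d : 0 <= t ->
  (forall s : K, 0 <= s -> f s = g s + c) ->
  has_derivative_nneg g t d -> has_derivative_nneg f t d.
Proof.
move=> t0 fg /(has_derivative_nnegP N_norm) H.
apply/(has_derivative_nnegP N_norm) => e /H; apply: filterS => s + s0.
by rewrite !fg// opprD addrACA subrr addr0; exact.
Qed.

Lemma has_derivative_nnegB f g t d d' :
  has_derivative_nneg f t d -> has_derivative_nneg g t d' ->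
  has_derivative_nneg (fun s => f s - g s) t (d - d').
Proof.
move=> /(has_derivative_nnegP N_norm) Hf /(has_derivative_nnegP N_norm) Hg.
apply/(has_derivative_nnegP N_norm) => e e0.
have e2 : 0 < e / 2 by rewrite divr_gt0.
apply: filterS (filterI (Hf _ e2) (Hg _ e2)) => s [{}Hf {}Hg] s0.
rewrite scalerBr.
have -> : f s - g s - (f t - g t) - ((s - t)%:C *: d - (s - t)%:C *: d') =
    f s - f t - (s - t)%:C *: d - (g s - g t - (s - t)%:C *: d').
  rewrite !opprD !opprK (addrACA (f s)).
  exact: addrACA.
apply: le_trans (normB N_norm _ _) _.
by have := Hf s0; have := Hg s0; lra.
Qed.

Lemma has_derivative_nnegZ (z : K[i]) f t d :
  has_derivative_nneg f t d ->
  has_derivative_nneg (fun s => z *: f s) t (z *: d).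
Proof.
move=> /(has_derivative_nnegP N_norm) Hf.
apply/(has_derivative_nnegP N_norm) => e e0.
have z0 : 0 <= complex.Re `|z| by rewrite normc_def sqrtr_ge0.
have z1 : 0 < complex.Re `|z| + 1 by rewrite ltr_wpDl.
apply: filterS (Hf _ (divr_gt0 e0 z1)) => s {}Hf s0.
rewrite scalerA mulrC -scalerA -!scalerBr (is_normZ N_norm).
apply: le_trans (ler_wpM2l z0 (Hf s0)) _.
rewrite mulrA ler_wpM2r// mulrCA ler_piMr ?(ltW e0)// ler_pdivrMr// mul1r.
by rewrite lerDl.
Qed.

Lemma has_derivative_nneg_shift f a t d : 0 <= a ->
  has_derivative_nneg f (t + a) d ->
  has_derivative_nneg (fun s => f (s + a)) t d.
Proof.
move=> a0 /(has_derivative_nnegP N_norm) Hf.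
apply/(has_derivative_nnegP N_norm) => e /Hf {}Hf.
have ca : {for t, continuous (fun s : K => s + a)}.
  by apply: continuousD; [exact: cvg_id|exact: cst_continuous].
apply: (filterS (F := nbhs t) _ (ca _ Hf)) => s /= H s0.
have sa : 0 <= s + a by rewrite addr_ge0.
by have := H sa; rewrite opprD addrACA subrr addr0.
Qed.

End DerivativeCalculus.

Section Solutions.
Context {K : realType} (h : K) {n : nat} (h_gt0 : 0 < h).
Local Notation Cn := 'cV[K[i]]_n.
Local Notation C := (Ccn h n).
Local Notation V := (@set_val _ `[- h, 0]%classic).
Context (N : Cn -> K) (N_norm : is_norm N).
Context (L R : {linear C -> Cn}).
Context (L_cont : continuous_for_norms (Ccn_norm N) N L).
Context (R_cont : continuous_for_norms (Ccn_norm N) N R).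
Implicit Types (v w q : K -> Cn) (t a : K).

Let h_ge0 : 0 <= h := ltW h_gt0.
Let normC := Ccn_norm_is_norm h_ge0 N_norm.

(* Only the values of v on [-h, +oo[ matter for being a solution, so v can be
   taken continuous on the whole line. *)
Definition gsolution q v : Prop :=
  continuous v /\ forall t, 0 <= t ->
    has_derivative_nneg (fun s => v s - L (seg h v s)) t (R (seg h v t) + q t).

Lemma gsolution_is_solution q v : gsolution q v -> is_solution L R q v.
Proof. by move=> [cv dv]; split; [exact: continuous_subspaceT|exact: dv]. Qed.

Lemma is_solution_gsolution q v : is_solution L R q v ->
  gsolution q (fun t => v (Num.max t (- h))) /\
  forall t, 0 <= t -> seg h (fun t => v (Num.max t (- h))) t = seg h v t.
Proof.
move=> [cv dv].
have E t : 0 <= t -> seg h (fun t => v (Num.max t (- h))) t = seg h v t.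
  by move=> t0; apply: seg_ext => // s; rewrite /=; case/andP => ? ?;
    rewrite max_l//; lra.
split; last exact: E.
split=> [|t t0]; first exact: continuous_within_max.
rewrite (E t t0).
apply: (has_derivative_nneg_ext N_norm (c := 0) t0 _ (dv _ t0)) => s s0.
have hs : - h <= s by rewrite (le_trans _ s0)// oppr_le0.
by rewrite (E s s0) addr0 max_l.
Qed.

Lemma gsolutionB q q' v w : gsolution q v -> gsolution q' w ->
  gsolution (fun t => q t - q' t) (fun t => v t - w t).
Proof.
move=> [cv dv] [cw dw]; split=> [x|t t0].
  by apply: continuousB; [exact: cv|exact: cw].
have := has_derivative_nnegB N_norm (dv _ t0) (dw _ t0).
rewrite (segB h t cv cw) linearB opprD addrACA.
apply: (has_derivative_nneg_ext N_norm (c := 0) t0) => s s0.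
rewrite (segB h s cv cw) linearB addr0 !opprD !opprK.
by rewrite addrACA.
Qed.

Lemma gsolutionZ (z : K[i]) q v : gsolution q v ->
  gsolution (fun t => z *: q t) (fun t => z *: v t).
Proof.
move=> [cv dv]; split=> [x|t t0]; first by apply: continuousZr; exact: cv.
have := has_derivative_nnegZ N_norm (z := z) (dv _ t0).
rewrite (segZ h z t cv) linearZ/= -scalerDr.
apply: (has_derivative_nneg_ext N_norm (c := 0) t0) => s s0.
by rewrite (segZ h z s cv) linearZ/= addr0 scalerBr.
Qed.

Lemma gsolution_shift q v a : 0 <= a -> gsolution q v ->
  gsolution (fun t => q (t + a)) (fun t => v (t + a)).
Proof.
move=> a0 [cv dv]; split=> [x|t t0].
  apply: (@continuous_comp _ _ _ (fun s => s + a) v); last exact: cv.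
  by apply: continuousD; [exact: cvg_id|exact: cst_continuous].
have ta : 0 <= t + a by rewrite addr_ge0.
have := has_derivative_nneg_shift N_norm a0 (dv _ ta).
rewrite (seg_shift h v a t).
apply: (has_derivative_nneg_ext N_norm (c := 0) t0) => s s0.
by rewrite (seg_shift h v a s) addr0.
Qed.

Lemma seg_eq0 v t s : continuous v -> seg h v t = 0 -> t - h <= s <= t ->
  v s = 0.
Proof.
move=> cv v0 st.
have vE := segE t (clamp h_ge0 (s - t)) cv.
move: vE; rewrite v0 set_val_clamp; last by lra.
by rewrite (addrC t) subrK => <-.
Qed.

Context (BR : K) (BR_gt0 : 0 < BR).
Context (R_bound : forall phi, N (R phi) <= BR * Ccn_norm N phi).
Context (BL Delta : K) (BL_gt0 : 0 < BL) (Delta_gt0 : 0 < Delta).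
Context (Delta_le_h : Delta <= h).
Context (L_bound : forall (phi : C) M,
    (forall s, V s <= - Delta -> N (phi s) <= M) -> N (L phi) <= BL * M).

(** As [e <= Delta <= h], the segment at [e] covers [0, e], and [z] vanishes before 0; so its norm
    [M] dominates all segments at times in [0, e]. The term with [R] then contributes at most
    [BR * M * e], which is moved to the left-hand side. *)
Lemma gsolution_norm_le q z e (G g : K -> K) : gsolution q z ->
  seg h z 0 = 0 -> 0 <= e <= Delta ->
  (forall t, 0 <= t <= e -> is_derive t 1 G (g t)) ->
  (forall t, 0 <= t <= e -> N (q t) <= g t) ->
  Ccn_norm N (seg h z e) * (1 - BR * e) <= G e - G 0.
Proof.
move=> [cz dz] z0 /andP[e0 eD] dG qg.
set M := Ccn_norm N (seg h z e).
have M0 : 0 <= M by exact: norm_ge0.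
have eh : e <= h by exact: le_trans eD _.
have zneg s : - h <= s <= 0 -> z s = 0.
  by move=> hs; apply: (seg_eq0 cz z0); rewrite sub0r.
have zM s : - h <= s <= e -> N (z s) <= M.
  move=> /andP[hs se]; have [s0|s0] := leP s 0.
    by rewrite zneg ?hs// (norm0 N_norm).
  have -> : z s = seg h z e (clamp h_ge0 (s - e)).
    apply: esym; apply: etrans (segE e _ cz) _.
    by rewrite set_val_clamp; [rewrite (addrC e) subrK|lra].
  exact: (norm_le_Ccn_norm h_ge0 N_norm).
have segM t : 0 <= t <= e -> Ccn_norm N (seg h z t) <= M.
  move=> /andP[t0 te]; apply: (Ccn_norm_le h_ge0) => s.
  have -> := segE t s cz.
  by apply: zM; have := Ih_itv s; lra.
(* For [s <= - Delta] one has [t + s <= e - Delta <= 0], where [z] vanishes, so [L_bound] applies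
   with the bound 0. *)
have Lz t : 0 <= t <= e -> L (seg h z t) = 0.
  move=> /andP[t0 te]; apply: (is_norm_eq0 N_norm); apply/eqP.
  rewrite eq_le (norm_ge0 N_norm) andbT -[leRHS](mulr0 BL).
  apply: L_bound => s sD; have -> := segE t s cz.
  by rewrite zneg ?(norm0 N_norm)//; have := Ih_itv s; lra.
(* Monotonicity of [G] is the mean value inequality for the zero function, since [g] dominates a
   norm and is nonnegative. *)
have Gmono t : 0 <= t <= e -> G t <= G e.
  move=> /andP[t0 te]; rewrite -subr_ge0 -(norm0 N_norm) -[X in N X](subrr 0).
  apply: (norm_mean_value N_norm (f := fun=> 0) (f' := fun=> 0) (g := g) t0 te).
  - by move=> x; exact: cst_continuous.
  - by move=> x /andP[tx xe]; apply: dG; rewrite (le_trans t0 tx).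
  - move=> x _; apply/(has_derivative_nnegP N_norm) => d d0.
    apply: (@filterE _ (nbhs x) _) => s _;
      by rewrite scaler0 !subrr (norm0 N_norm) mulr_ge0 ?(ltW d0).
  - move=> x /andP[tx xe]; rewrite (norm0 N_norm); apply: le_trans (qg x _).
      exact: norm_ge0.
    by rewrite (le_trans t0 tx).
suff H : M <= G e - G 0 + BR * M * e by lra.
apply: (Ccn_norm_le h_ge0) => s; have -> := segE e s cz.
have /andP[hs s0] := Ih_itv s; set t := e + V s.
have te : t <= e by rewrite gerDl.
have RHS0 : 0 <= G e - G 0 + BR * M * e.
  have e00 : 0 <= (0 : K) <= e by apply/andP; split.
  have G0e : G 0 <= G e := Gmono 0 e00.
  by rewrite addr_ge0 ?subr_ge0// !mulr_ge0// ltW.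
have [t0|t0] := leP t 0.
  by rewrite zneg ?(norm0 N_norm)// t0 andbT /t; lra.
pose f x := z x - L (seg h z x).
have -> : z t = f t - f 0.
  have te0 : 0 <= t <= e by rewrite (ltW t0).
  have e00 : 0 <= (0 : K) <= e by apply/andP; split.
  have h00 : - h <= 0 <= (0 : K) by apply/andP; split; rewrite ?oppr_le0.
  have ft : f t = z t by apply: etrans (subr0 _); congr (_ - _); exact: Lz.
  have f0 : f 0 = 0.
    by apply: etrans (subr0 _); congr (_ - _); [exact: zneg|exact: Lz].
  by rewrite ft f0 subr0.
have cf : continuous f.
  move=> x; apply: (@continuousB _ _ _ z (fun t => L (seg h z t)));
    first exact: cz.
  exact: (continuous_linear_seg h_ge0 N_norm L_cont cz).
have dG' x : 0 <= x <= t ->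
    is_derive x 1 (fun x => G x + (BR * M) * x) (g x + BR * M).
  move=> /andP[x0 xt]; have dGx : is_derive x 1 G (g x).
    by apply: dG; rewrite x0 (le_trans xt).
  apply: is_deriveD; rewrite -[X in is_derive _ _ _ X]mulr1.
  exact: is_deriveZ.
have := norm_mean_value N_norm (lexx 0) (ltW t0) cf dG'
   (f' := fun x => R (seg h z x) + q x).
move=> H; apply: le_trans (H _ _) _.
- by move=> x /andP[x0 xt]; exact: dz.
- move=> x /andP[x0 xt]; have xe : 0 <= x <= e by rewrite x0 (le_trans xt).
  apply: le_trans (is_normD N_norm _ _) _; rewrite [leRHS]addrC.
  apply: lerD; last exact: qg.
  apply: le_trans (R_bound _) _.
  apply: ler_wpM2l; first exact: ltW.
  exact: segM.
rewrite mulr0 addr0.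
have : BR * M * t <= BR * M * e by rewrite ler_wpM2l// mulr_ge0// ltW.
have : G t <= G e by apply: Gmono; rewrite (ltW t0).
by lra.
Qed.

(** Without forcing, [gsolution_norm_le] holds with [G = 0] and makes [z] vanish on one step;
    shifting in time by multiples of [e] reaches every [t]. *)
Lemma gsolution_unique z t : gsolution (fun=> 0) z -> seg h z 0 = 0 ->
  - h <= t -> z t = 0.
Proof.
move=> zsol z0 ht.
(* The second bound gives [BR * e <= 1 / 2], so the factor [1 - BR * e] is positive. *)
pose e := Num.min Delta (BR * 2)^-1.
have e0 : 0 < e by rewrite lt_min Delta_gt0 invr_gt0 mulr_gt0.
have eD : 0 <= e <= Delta by rewrite (ltW e0) ge_min lexx.
have BRe : BR * e <= 2^-1.
  have : e <= (BR * 2)^-1 by rewrite ge_min lexx orbT.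
  by rewrite -(ler_pM2l BR_gt0) invfM mulrA mulfV ?mul1r// gt_eqF.
have H k : forall s, - h <= s <= k%:R * e -> z s = 0.
  elim: k => [s|k IH s].
    by rewrite mul0r => hs; apply: (seg_eq0 zsol.1 z0); rewrite sub0r.
  have [sk|sk] := leP s (k%:R * e).
    by move=> /andP[hs _]; apply: IH; rewrite hs.
  move=> /andP[hs sk1]; have k0 : 0 <= k%:R * e by rewrite mulr_ge0// ltW.
  have sol' := gsolution_shift k0 zsol.
  have s0' : seg h (fun t => z (t + k%:R * e)) 0 = 0.
    apply: CcnP => x; apply: etrans (segE 0 x sol'.1) _.
    by apply: IH; have := Ih_itv x; lra.
  have dG x : 0 <= x <= e -> is_derive x 1 (fun=> 0 : K) 0.
    by move=> _; exact: is_derive_cst.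
  have qg x : 0 <= x <= e -> N 0 <= 0 by rewrite (norm0 N_norm).
  have := gsolution_norm_le sol' s0' eD dG qg; rewrite subrr => H.
  have {}H : seg h (fun t => z (t + k%:R * e)) e = 0.
    apply: (is_norm_eq0 normC); apply/eqP.
    have := norm_ge0 normC (seg h (fun t => z (t + k%:R * e)) e).
    by rewrite eq_le => ->; rewrite andbT; nra.
  have := seg_eq0 (s := s - k%:R * e) sol'.1 H; rewrite subrK; apply.
  have := Delta_le_h; move: sk1 eD; rewrite mulrSr mulrDl mul1r; lra.
have [t0|t0] := leP t 0; first by apply: (H 0%N); rewrite mul0r ht.
have := archi_boundP (divr_ge0 (ltW t0) (ltW e0)).
rewrite ltr_pdivrMr// => tk.
by apply: (H (Num.bound (t / e))); rewrite ht ltW.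
Qed.

End Solutions.

(** * Existence of homogeneous solutions *)

Section GeometricLimits.
Context {K : realType}.

Lemma le0_of_le_half (x B : K) : (forall k, x <= B / 2 ^+ k) -> x <= 0.
Proof.
move=> H; rewrite leNgt; apply/negP => x0.
have B0 : 0 < B by have := H 0%N; rewrite expr0 divr1; exact: lt_le_trans.
pose k := Num.bound (B / x).
have := H k; apply/negP; rewrite -ltNge ltr_pdivrMr ?exprn_gt0// mulrC.
rewrite -ltr_pdivrMr//; apply: lt_le_trans (archi_boundP _) _.
  by rewrite divr_ge0// ltW.
by rewrite -natrX ler_nat ltnW// ltn_expl.
Qed.

(** The intervals with centre [y k] and radius [2 * B / 2 ^+ k], the tail of the geometric series,
    are nested; the supremum of their left ends lies in all of them. *)
Lemma geometric_cvg (y : nat -> K) B :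
  (forall k, `|y k.+1 - y k| <= B / 2 ^+ k) ->
  exists l, forall k, `|l - y k| <= 2 * B / 2 ^+ k.
Proof.
move=> H.
pose r k := 2 * B / 2 ^+ k.
have rS k : r k = r k.+1 + B / 2 ^+ k.
  by rewrite /r exprS invfM; field; rewrite expf_neq0.
have r0 k : 0 <= r k.
  by rewrite /r -mulrA mulr_ge0//; apply: le_trans (H k).
pose lo k := y k - r k; pose hi k := y k + r k.
have loS k : lo k <= lo k.+1.
  by have := H k; have := rS k; rewrite /lo ler_norml; lra.
have hiS k : hi k.+1 <= hi k.
  by have := H k; have := rS k; rewrite /hi ler_norml; lra.
have lo_le j k : (j <= k)%N -> lo j <= lo k.
  by move=> /subnK <-; elim: (k - j)%N => // i /le_trans; apply; rewrite addSn.
have hi_le j k : (j <= k)%N -> hi k <= hi j.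
  by move=> /subnK <-; elim: (k - j)%N => // i; apply: le_trans; rewrite addSn.
have lohi j k : lo j <= hi k.
  apply: le_trans (lo_le _ _ (leq_maxl j k)) _.
  apply: le_trans (hi_le _ _ (leq_maxr j k)).
  by have := r0 (maxn j k); rewrite /lo /hi; lra.
pose E := range lo.
have E0 : E !=set0 by exists (lo 0%N), 0%N.
exists (sup E) => k; rewrite ler_norml; apply/andP; split.
  have : lo k <= sup E
    by apply: ub_le_sup; [exists (hi 0%N) => _ [j _ <-]|exists k].
  by rewrite /lo -/(r k); lra.
have : sup E <= hi k by apply: ge_sup => // _ [j _ <-].
by rewrite /hi -/(r k); lra.
Qed.

End GeometricLimits.

(** Convergence of the real coordinates, with [D] paying for the two changes of norm. [D] is fixed
    before the sequence, so the Picard iterates converge with the same factor at all times. *)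
Lemma vector_geometric_cvg {K : realType} {n : nat} (N : 'cV[K[i]]_n -> K)
    (N_norm : is_norm N) :
  exists2 D, 0 < D & forall (x : nat -> 'cV[K[i]]_n) B,
    (forall k, N (x k.+1 - x k) <= B / 2 ^+ k) ->
    exists l, forall k, N (l - x k) <= D * B / 2 ^+ k.
Proof.
have [C1 C1_0 NC1] := norm_le_l1norm N_norm.
have [C2 C2_0 NC2] := l1norm_le_norm N_norm.
exists (C1 * n%:R * (4 * C2) + 1).
  by rewrite ltr_wpDl// !mulr_ge0// ltW.
move=> x B H.
have B0 : 0 <= B.
  by have := H 0%N; rewrite expr0 divr1; apply: le_trans; exact: norm_ge0.
have le_l1 (y : 'cV[K[i]]_n) j :
    `|complex.Re (y j 0)| <= l1norm y /\ `|complex.Im (y j 0)| <= l1norm y.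
  have : `|complex.Re (y j 0)| + `|complex.Im (y j 0)| <= l1norm y.
    by rewrite /l1norm (bigD1 j)//= lerDl sumr_ge0// => k _; rewrite addr_ge0.
  have := normr_ge0 (complex.Re (y j 0)).
  have := normr_ge0 (complex.Im (y j 0)).
  by lra.
have l1x k : l1norm (x k.+1 - x k) <= C2 * B / 2 ^+ k.
  by apply: le_trans (NC2 _) _; rewrite -mulrA ler_pM2l.
have ReH j k : `|complex.Re (x k.+1 j 0) - complex.Re (x k j 0)| <=
  C2 * B / 2 ^+ k.
  apply: le_trans (l1x k); have := (le_l1 (x k.+1 - x k) j).1.
  by rewrite !mxE; case: (x k.+1 j 0) (x k j 0) => ? ? [].
have ImH j k : `|complex.Im (x k.+1 j 0) - complex.Im (x k j 0)| <=
  C2 * B / 2 ^+ k.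
  apply: le_trans (l1x k); have := (le_l1 (x k.+1 - x k) j).2.
  by rewrite !mxE; case: (x k.+1 j 0) (x k j 0) => ? ? [].
have /choice[a Ha] j := geometric_cvg (ReH j).
have /choice[b Hb] j := geometric_cvg (ImH j).
exists (\col_j (a j +i* b j)) => k.
apply: le_trans (NC1 _) _.
have -> : (C1 * n%:R * (4 * C2) + 1) * B / 2 ^+ k =
   C1 * (n%:R * (2 * (C2 * B) / 2 ^+ k + 2 * (C2 * B) / 2 ^+ k)) + B / 2 ^+ k.
  by ring.
rewrite -[leLHS]addr0 lerD ?divr_ge0 ?exprn_ge0// ler_pM2l//.
have -> : n%:R * (2 * (C2 * B) / 2 ^+ k + 2 * (C2 * B) / 2 ^+ k) =
    \sum_(j < n) (2 * (C2 * B) / 2 ^+ k + 2 * (C2 * B) / 2 ^+ k).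
  by rewrite sumr_const card_ord mulr_natl.
apply: ler_sum => j _; rewrite !mxE.
have := Ha j k; have := Hb j k.
by case: (x k j 0) => ? ? /= ? ?; rewrite lerD.
Qed.

Section Existence.
Context {K : realType} (h : K) {n : nat} (h_gt0 : 0 < h).
Local Notation Cn := 'cV[K[i]]_n.
Local Notation C := (Ccn h n).
Local Notation V := (@set_val _ `[- h, 0]%classic).
Context (N : Cn -> K) (N_norm : is_norm N).
Context (L R : {linear C -> Cn}).
Context (L_cont : continuous_for_norms (Ccn_norm N) N L).
Context (R_cont : continuous_for_norms (Ccn_norm N) N R).
Context (BR : K) (BR_gt0 : 0 < BR).
Context (R_bound : forall phi, N (R phi) <= BR * Ccn_norm N phi).
Context (BL Delta : K) (BL_gt0 : 0 < BL) (Delta_gt0 : 0 < Delta).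
Context (L_bound : forall (phi : C) M,
    (forall s, V s <= - Delta -> N (phi s) <= M) -> N (L phi) <= BL * M).
Context (phi : C).
Implicit Types (u v : K -> Cn) (t : K).

Let h_ge0 : 0 <= h := ltW h_gt0.
(** The first summand gives [BL * expR (- (rate * Delta)) <= 1 / 4], through [1 + x <= expR x]; the
    second gives [BR / rate <= 1 / 4]. Together they yield the contraction factor 1/2. The last one
    ensures [1 <= rate]. *)
Let rate : K := 4 * BL / Delta + 4 * BR + 1.

Let rate_gt0 : 0 < rate.
Proof. by rewrite ltr_wpDl// addr_ge0// !mulr_ge0// ?invr_ge0 ltW. Qed.

Let Rseg_continuous u : continuous u -> continuous (fun t => R (seg h u t)).
Proof. by move=> cu; exact: (continuous_linear_seg h_ge0 N_norm R_cont cu). Qed.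

(* The delay makes L contribute the factor exp (- rate * Delta). *)
Lemma picard_contraction (u P : K -> Cn) B t : continuous u -> continuous P ->
  (forall s, 0 <= s -> has_derivative_nneg P s (R (seg h u s))) ->
  (forall s, N (u s) <= B * expR (rate * s)) -> 0 <= t ->
  N (L (seg h u t) + (P t - P 0)) <= B / 2 * expR (rate * t).
Proof.
move=> cu cP dP uB t0.
have B0 : 0 <= B.
  rewrite -(pmulr_lge0 _ (expR_gt0 (rate * 0))).
  by apply: le_trans (uB 0); exact: norm_ge0.
have mono s x : s <= x -> B * expR (rate * s) <= B * expR (rate * x).
  by move=> sx; rewrite ler_wpM2l// ler_expR ler_pM2l.
have HL : N (L (seg h u t)) <= BL * (B * expR (rate * (t - Delta))).
  apply: L_bound => s sD; have -> := segE t s cu.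
  by apply: le_trans (uB _) _; apply: mono; rewrite lerD2l.
have HR s : 0 <= s <= t -> N (R (seg h u s)) <= BR * (B * expR (rate * s)).
  move=> _; apply: le_trans (R_bound _) _; apply: ler_wpM2l; first exact: ltW.
  apply: (Ccn_norm_le h_ge0) => x; have -> := segE s x cu.
  apply: le_trans (uB _) _; apply: mono.
  by rewrite gerDl; have /andP[] := Ih_itv x.
(* A primitive of the bound [HR]; integrating the exponential gains the factor [1 / rate]. *)
pose G s := BR * B / rate * expR (rate * s).
have dG s : 0 <= s <= t -> is_derive s 1 G (BR * (B * expR (rate * s))).
  move=> _; have de : is_derive s 1 (fun x => expR (rate * x))
      (rate * expR (rate * s)).
    have dl : is_derive s 1 (fun x => rate * x) rate.
      by rewrite -[X in is_derive _ _ _ X]mulr1; exact: is_deriveZ.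
    have := is_derive1_comp (is_derive_expR (rate * s)) dl.
    by rewrite mulrC.
  have -> : BR * (B * expR (rate * s)) =
    BR * B / rate * (rate * expR (rate * s)).
    by rewrite [RHS]mulrA divfK ?gt_eqF// mulrA.
  exact: is_deriveZ.
have HP : N (P t - P 0) <= G t - G 0.
  apply: (norm_mean_value N_norm (lexx 0) t0 cP dG) => s /andP[s0 st].
    exact: dP.
  by apply: HR; rewrite s0.
apply: le_trans (is_normD N_norm _ _) _.
have G0 : 0 <= G 0 by rewrite /G !mulr_ge0 ?expR_ge0 ?invr_ge0// ltW.
set e := expR (rate * t); have e0 : 0 < e by exact: expR_gt0.
have H1 : BL * expR (- (rate * Delta)) <= 4^-1.
  rewrite expRN ler_pdivrMr ?expR_gt0//.
  have := expR_ge1Dx (rate * Delta).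
  have : 4 * BL <= rate * Delta.
    rewrite /rate !mulrDl divfK ?gt_eqF// mul1r.
    have := mulr_gt0 BR_gt0 Delta_gt0; have := Delta_gt0; lra.
  by lra.
have H2 : BR / rate <= 4^-1.
  rewrite ler_pdivrMr//.
  have : 0 <= 4 * BL / Delta by rewrite !mulr_ge0 ?invr_ge0// ltW.
  by rewrite /rate; lra.
have H3 : BL * (B * expR (rate * (t - Delta))) <= 4^-1 * (B * e).
  rewrite mulrBr expRD -/e mulrA mulrA [BL * _ * _ * _]mulrC.
  have -> : expR (- (rate * Delta)) * (BL * B * e) =
    BL * expR (- (rate * Delta)) * (B * e) by ring.
  by apply: ler_wpM2r H1; rewrite mulr_ge0// ltW.
have H4 : G t <= 4^-1 * (B * e).
  rewrite /G -/e.
  have -> : BR * B / rate * e = BR / rate * (B * e) by ring.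
  by apply: ler_wpM2r H2; rewrite mulr_ge0// ltW.
have -> : B / 2 * e = 4^-1 * (B * e) + 4^-1 * (B * e) by field.
apply: le_trans (lerD HL HP) _; apply: lerD H3 _; lra.
Qed.

(** The solution is a fixed point of the integrated equation v(t) = phi(0) - L phi + L v_t +
    (integral of R v_s over [0, t]). No weighted function space is built: the weighted norm only
    occurs through pointwise bounds [B * expR (rate * s)]. *)
Lemma homogeneous_solution_exists :
  exists v, gsolution L R (fun=> 0) v /\ seg h v 0 = phi.
Proof.
(* [Pr u] plays the integral of R u_s from 0; it is arbitrary for discontinuous [u]. *)
have /choice[Pr PrP] (u : K -> Cn) : exists F : K -> Cn, continuous u ->
    [/\ continuous F, F 0 = 0 &
      forall t, 0 <= t -> has_derivative_nneg F t (R (seg h u t))].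
  have [cu|ncu] := pselect (continuous u); last by exists u => /ncu.
  by have [F HF] := vector_primitive N_norm (Rseg_continuous cu); exists F.
pose p t := phi (clamp h_ge0 t).
have cp : continuous p by exact: Ccn_extension_continuous.
have pE t : 0 <= t -> p t = p 0.
  move=> t0; congr (phi _); apply: val_inj => /=.
  by rewrite !min_r// ?le_max ?lexx ?t0.
(* For [t <= 0] both corrections vanish as soon as [u] has initial segment [phi], so [T] preserves
   the initial condition. *)
pose T u t : Cn :=
  p t + (L (seg h u (Num.max t 0)) - L phi) + Pr u (Num.max t 0).
have cmax : continuous (fun t : K => Num.max t 0).
  move=> t; apply: (@continuous_max _ _ (fun x : K => x) (cst 0)).
    exact: cvg_id.
  exact: cst_continuous.
have cT u : continuous u -> continuous (T u).
  move=> cu t.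
  have c1 : {for t, continuous (fun t => L (seg h u (Num.max t 0)))}.
    apply: (@continuous_comp _ _ _ (fun t => Num.max t 0)
      (fun t => L (seg h u t))).
      exact: cmax.
    exact: (continuous_linear_seg h_ge0 N_norm L_cont cu).
  have c2 : {for t, continuous (fun t => Pr u (Num.max t 0))}.
    apply: (@continuous_comp _ _ _ (fun t => Num.max t 0) (Pr u));
      first exact: cmax.
    by have [cP _ _] := PrP u cu; exact: cP.
  apply: (@continuousD _ _ _
    (fun t => p t + (L (seg h u (Num.max t 0)) - L phi))
    (fun t => Pr u (Num.max t 0))); last exact: c2.
  apply: (@continuousD _ _ _ p (fun t => L (seg h u (Num.max t 0)) - L phi)).
    exact: cp.
  apply: (@continuousB _ _ _ (fun t => L (seg h u (Num.max t 0)))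
    (cst (L phi))).
    exact: c1.
  exact: cst_continuous.
have seg0 u : continuous u -> (forall t, t <= 0 -> u t = p t) ->
  seg h u 0 = phi.
  move=> cu up; rewrite -[RHS](seg_extension h_ge0 phi).
  by apply: seg_ext => s /andP[_ s0]; exact: up.
have Tneg u t : continuous u -> (forall t, t <= 0 -> u t = p t) -> t <= 0 ->
    T u t = p t.
  move=> cu up t0; rewrite /T max_r// (seg0 _ cu up) subrr addr0.
  by have [_ -> _] := PrP u cu; rewrite addr0.
have Tcontr u v B t : continuous u -> continuous v ->
    (forall s, N (u s - v s) <= B * expR (rate * s)) -> 0 <= t ->
    N (T u t - T v t) <= B / 2 * expR (rate * t).
  move=> cu cv uv t0.
  have [cP1 P10 dP1] := PrP u cu; have [cP2 P20 dP2] := PrP v cv.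
  have cuv : continuous (fun s => u s - v s).
    by move=> x; apply: continuousB; [exact: cu|exact: cv].
  have cP : continuous (fun s => Pr u s - Pr v s).
    by move=> x; apply: continuousB; [exact: cP1|exact: cP2].
  have dP s : 0 <= s -> has_derivative_nneg (fun s => Pr u s - Pr v s) s
      (R (seg h (fun s => u s - v s) s)).
    move=> s0; have := has_derivative_nnegB N_norm (dP1 _ s0) (dP2 _ s0).
    by rewrite (segB h s cu cv) linearB.
  have := picard_contraction cuv cP dP uv t0.
  rewrite P10 P20 subrr subr0.
  rewrite (segB h t cu cv) linearB.
  suff -> : T u t - T v t =
     L (seg h u t) - L (seg h v t) + (Pr u t - Pr v t) by [].
  rewrite /T max_l// opprD addrACA; congr (_ + _).
  by rewrite opprD addrACA subrr add0r opprB addrA subrK.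
pose x k := iter k T p.
have cx k : continuous (x k) by elim: k => [|k IH];
  [exact: cp|exact: (cT _ IH)].
have xneg k t : t <= 0 -> x k t = p t.
  elim: k t => [//|k IH] t t0; exact: (Tneg (x k) t (cx k) IH t0).
pose M := Ccn_norm N phi.
have pM t : N (p t) <= M by exact: (norm_le_Ccn_norm h_ge0 N_norm).
have M0 : 0 <= M by apply: le_trans (pM 0); exact: norm_ge0.
(* The first increment involves two values of [L] and an integral of [R], all at segments bounded by
   [M]; hence it is at most [A * (1 + t)], and [1 <= rate] turns [1 + t] into the exponential
   weight. *)
pose A := 2 * BL * M + BR * M.
have rate1 : 1 <= rate.
  have : 0 <= 4 * BL / Delta by rewrite !mulr_ge0 ?invr_ge0// ltW.
  by have := BR_gt0; rewrite /rate; lra.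
have d0 t : 0 <= t -> N (T p t - p t) <= A * expR (rate * t).
  move=> t0; have [cP P0 dP] := PrP p cp.
  have -> : T p t - p t = L (seg h p t) - L phi + (Pr p t - Pr p 0).
    by rewrite /T max_l// P0 subr0 -(addrA (p t)) (addrC (p t)) addrK.
  have e1 : 1 + t <= expR (rate * t).
    apply: le_trans (expR_ge1Dx _); rewrite lerD2l.
    by rewrite ler_peMl.
  have H1 : N (L (seg h p t)) <= BL * M.
    by apply: L_bound => s _; have -> := segE t s cp; exact: pM.
  have H2 : N (L phi) <= BL * M.
    by apply: L_bound => s _; exact: (norm_le_Ccn_norm h_ge0 N_norm).
  have dG s : 0 <= s <= t -> is_derive s 1 (fun x => BR * M * x) (BR * M).
    move=> _; rewrite -[X in is_derive _ _ _ X]mulr1; exact: is_deriveZ.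
  have H3 : N (Pr p t - Pr p 0) <= BR * M * t - BR * M * 0.
    apply: (norm_mean_value N_norm (lexx 0) t0 cP dG) => s /andP[s0 st].
      exact: dP.
    apply: le_trans (R_bound _) _; apply: ler_wpM2l; first exact: ltW.
    apply: (Ccn_norm_le h_ge0) => y; have -> := segE s y cp.
    exact: pM.
  apply: le_trans (is_normD N_norm _ _) _.
  apply: le_trans (lerD (normB N_norm _ _) H3) _.
  apply: (@le_trans _ _ (A * (1 + t))); last first.
    by rewrite ler_wpM2l// /A addr_ge0// !mulr_ge0// ltW.
  have : 0 <= BL * M * t by rewrite !mulr_ge0// ltW.
  have : 0 <= BR * M by rewrite !mulr_ge0// ltW.
  rewrite /A mulr0 subr0; nra.
have A0 : 0 <= A by rewrite /A addr_ge0// !mulr_ge0// ltW.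
have dx k t : N (x k.+1 t - x k t) <= A / 2 ^+ k * expR (rate * t).
  have [t0|t0] := leP t 0.
    rewrite (xneg k t t0) (xneg k.+1 t t0) subrr (norm0 N_norm).
    by rewrite !mulr_ge0 ?expR_ge0 ?invr_ge0 ?exprn_ge0.
  elim: k t t0 => [|k IH] t t0.
    by rewrite expr0 divr1; exact: d0 (ltW t0).
  rewrite exprSr invfM mulrA.
  apply: (Tcontr (x k.+1) (x k) _ t (cx _) (cx _) _ (ltW t0)) => s.
  have [s0|s0] := leP s 0; last exact: IH.
  rewrite (xneg k s s0) (xneg k.+1 s s0) subrr (norm0 N_norm).
  by rewrite !mulr_ge0 ?expR_ge0 ?invr_ge0 ?exprn_ge0.
have [D D0 Dcvg] := vector_geometric_cvg N_norm.
have /choice[v Hv] t : exists l, forall k,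
    N (l - x k t) <= D * (A * expR (rate * t)) / 2 ^+ k.
  by apply: Dcvg => k; rewrite mulrAC; exact: dx.
have vneg t : t <= 0 -> v t = p t.
  move=> t0; apply/eqP; rewrite -subr_eq0; apply/eqP/(is_norm_eq0 N_norm)/eqP.
  rewrite eq_le (norm_ge0 N_norm) andbT.
  apply: (@le0_of_le_half _ _ (D * (A * expR (rate * t)))) => k.
  by rewrite -(xneg k t t0); exact: Hv.
(* The weight is increasing, so the iterates converge uniformly on ]-oo, t + 1], a neighbourhood of
   [t]. *)
have cv : continuous v.
  apply/(norm_continuousP N_norm) => t e e0.
  pose B := D * (A * expR (rate * (t + 1))).
  have [k Hk] : exists k, B / 2 ^+ k < e / 4.
    apply: contrapT => /forallNP H.
    suff : e / 4 <= 0 by lra.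
    have HB k : e / 4 <= B / 2 ^+ k by rewrite leNgt; apply/negP/H.
    exact: le0_of_le_half HB.
  have vx s : s <= t + 1 -> N (v s - x k s) < e / 4.
    move=> st; apply: le_lt_trans (Hv s k) (le_lt_trans _ Hk).
    rewrite ler_wpM2r ?invr_ge0 ?exprn_ge0//.
    by rewrite /B ler_pM2l// ler_wpM2l// ler_expR ler_pM2l.
  have e2 : 0 < e / 2 by rewrite divr_gt0.
  have H1 := (norm_continuousP N_norm _).1 (cx k) t _ e2.
  have H2 : \forall s \near t, s < t + 1 by apply: lt_nbhsl; rewrite ltrDl.
  apply: filterS (filterI H1 H2) => s [{}H1 {}H2].
  have := vx _ (ltW H2).
  have : N (v t - x k t) < e / 4 by apply: vx; rewrite lerDl.
  rewrite (norm_distC N_norm (v t)) => vt vs.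
  have -> : v s - v t = (v s - x k s) + ((x k s - x k t) + (x k t - v t)).
    by rewrite subrKA subrKA.
  apply: le_lt_trans (is_normD N_norm _ _) _.
  have := is_normD N_norm (x k s - x k t) (x k t - v t); lra.
(* [T (x k)] is the next iterate: it is close to [v] by the rate of convergence, and to [T v] by
   contraction. *)
have vfix t : 0 <= t -> v t = T v t.
  move=> t0; apply/eqP; rewrite -subr_eq0; apply/eqP/(is_norm_eq0 N_norm)/eqP.
  rewrite eq_le (norm_ge0 N_norm) andbT.
  pose B := D * (A * expR (rate * t)).
  apply: (@le0_of_le_half _ _ B) => k.
  have -> : v t - T v t = (v t - T (x k) t) - (T v t - T (x k) t).
    by rewrite (opprB (T v t)) subrKA.
  apply: le_trans (normB N_norm _ _) _.
  have H1 : N (v t - T (x k) t) <= D * (A * expR (rate * t)) / 2 ^+ k.+1 :=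
    Hv t k.+1.
  have H2 : N (T v t - T (x k) t) <= D * A / 2 ^+ k / 2 * expR (rate * t).
    apply: (Tcontr v (x k) _ t cv (cx k) _ t0) => s.
    by apply: le_trans (Hv s k) _; rewrite mulrA mulrAC.
  have -> : B / 2 ^+ k = D * (A * expR (rate * t)) / 2 ^+ k.+1 +
      D * A / 2 ^+ k / 2 * expR (rate * t).
    by rewrite /B exprS invfM; field; rewrite expf_neq0.
  exact: lerD.
exists v; split; last exact: seg0 cv vneg.
split=> [//|t t0]; rewrite addr0.
have [_ _ /(_ t t0) dP] := PrP v cv.
(* By the fixed point equation, v(s) - L v_s differs from the primitive [Pr v] by this constant on
   [s >= 0]. *)
apply: (has_derivative_nneg_ext N_norm (c := p 0 - L phi) t0 _ dP) => s s0.
rewrite (vfix s s0) /T max_l// (pE s s0) (addrC (L (seg h v s))) (addrA (p 0)).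
by rewrite (addrAC (p 0 - L phi)) addrK addrC.
Qed.

End Existence.

(** * The semigroup *)

(** The hypothesis is an inequality between continuous functions of [e] that reduces to the
    conclusion at [e = 0]. If the conclusion failed, the inequality would fail for all small [e],
    among which are steps [t / m.+1%:R]. *)
Lemma le_of_subdivisions {K : realType} (t D b g X W B c : K) :
  0 <= t -> 0 < D -> 0 < b ->
  (forall m, let e := t / m.+1%:R in m.+1%:R * e = t -> e <= D -> b * e < 1 ->
     X * (1 - b * e) <= c * (W * (1 - b * e) + expR (g * e) * B)) ->
  X <= c * (W + B).
Proof.
move=> t0 D0 b0 H; rewrite leNgt; apply/negP => XWB.
pose f (e : K) := c * (W * (1 - b * e) + expR (g * e) * B) - X * (1 - b * e).
have cf : {for 0, continuous f}.
  have c1 : {for (0 : K), continuous (fun e : K => 1 - b * e)}.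
    apply: continuousB; first exact: cst_continuous.
    by apply: (@continuousM _ _ (cst b) (fun x => x));
      [exact: cst_continuous|exact: cvg_id].
  have c2 : {for (0 : K), continuous (fun e : K => expR (g * e))}.
    apply: (@continuous_comp _ _ _ (fun e => g * e) expR);
      last exact: continuous_expR.
    by apply: (@continuousM _ _ (cst g) (fun x => x));
      [exact: cst_continuous|exact: cvg_id].
  apply: continuousB; apply: continuousM; try exact: cst_continuous.
    apply: continuousD; apply: continuousM; try exact: cst_continuous.
      exact: c1.
    exact: c2.
  exact: c1.
have f0 : f 0 < 0 by rewrite /f !mulr0 expR0 subr0 !mulr1 mul1r subr_lt0.
have /cvgrPdist_lt/(_ (- f 0)) := cf.
rewrite oppr_gt0 => /(_ f0)/nbhs_ballP[d /= d0 Hd].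
pose r := Num.min (d / 2) (Num.min D (b * 2)^-1).
have r0 : 0 < r by rewrite !lt_min D0 divr_gt0// invr_gt0 mulr_gt0.
pose m := Num.bound (t / r); pose e := t / m.+1%:R.
have me : m.+1%:R * e = t by rewrite /e mulrC divfK// pnatr_eq0.
have er : e < r.
  rewrite /e ltr_pdivrMr// -ltr_pdivrMl// mulrC.
  apply: lt_trans (archi_boundP _) _; first by rewrite divr_ge0// ltW.
  by rewrite ltr_nat.
have e0 : 0 <= e by rewrite divr_ge0.
have [ed eD eb] : [/\ e < d, e <= D & b * e < 1].
  move: er; rewrite !lt_min => /and3P[e1 e2 e3]; split; [lra|exact: ltW|].
  have bb : b * (b * 2)^-1 = 2^-1 by rewrite invfM mulrA mulfV ?mul1r// gt_eqF.
  have : b * e < b * (b * 2)^-1 by rewrite ltr_pM2l.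
  by rewrite bb; lra.
have /Hd /= : ball 0 d e by rewrite /ball/= sub0r normrN ger0_norm.
rewrite ltr_norml => /andP[].
by have := H m me eD eb; rewrite -subr_ge0 -/(f e); lra.
Qed.

Section Semigroup.
Context {K : realType} (h : K) {n : nat} (h_gt0 : 0 < h).
Local Notation Cn := 'cV[K[i]]_n.
Local Notation C := (Ccn h n).
Local Notation V := (@set_val _ `[- h, 0]%classic).
Context (N : Cn -> K) (N_norm : is_norm N).
Context (L R : {linear C -> Cn}).
Context (L_cont : continuous_for_norms (Ccn_norm N) N L).
Context (R_cont : continuous_for_norms (Ccn_norm N) N R).
Context (BR : K) (BR_gt0 : 0 < BR).
Context (R_bound : forall phi, N (R phi) <= BR * Ccn_norm N phi).
Context (BL Delta : K) (BL_gt0 : 0 < BL) (Delta_gt0 : 0 < Delta).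
Context (Delta_le_h : Delta <= h).
Context (L_bound : forall (phi : C) M,
    (forall s, V s <= - Delta -> N (phi s) <= M) -> N (L phi) <= BL * M).
Implicit Types (phi psi : C) (v w q : K -> Cn) (t : K).

Let h_ge0 : 0 <= h := ltW h_gt0.
Let normC := Ccn_norm_is_norm h_ge0 N_norm.

Let hsol_exists phi : exists v, gsolution L R (fun=> 0) v /\ seg h v 0 = phi.
Proof.
exact: (homogeneous_solution_exists h_gt0 N_norm L_cont R_cont BR_gt0 R_bound
  BL_gt0 Delta_gt0 L_bound phi).
Qed.

(** Uniqueness removes the arbitrary choice in [hsol]. All properties of S(t) below are read off
    from suitable solutions through this lemma. *)
Lemma solS_seg phi v t : gsolution L R (fun=> 0) v -> seg h v 0 = phi ->
  0 <= t -> solS L R t phi = seg h v t.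
Proof.
move=> vsol v0 t0; rewrite /solS.
have [u_sol u0] : is_solution_from L R (fun=> 0) phi (hsol L R phi).
  apply: (@xgetPex _ _ [set u | is_solution_from L R (fun=> 0) phi u]).
  by exists v; split; [exact: gsolution_is_solution|exact: v0].
have [usol uE] := is_solution_gsolution h_gt0 N_norm u_sol.
rewrite -(uE t t0); move: (uE 0 (lexx 0)) usol; rewrite u0.
set u := (fun t => hsol L R phi (Num.max t (- h))) => u0' usol.
have := gsolutionB N_norm usol vsol.
have -> : (fun=> 0 - 0 : Cn) = (fun=> 0) :> (K -> Cn).
  by apply/funext => x; rewrite subr0.
move=> dsol; apply: seg_ext => s /andP[ts _].
have d0 : seg h (fun t => u t - v t) 0 = 0.
  by rewrite (segB h 0 usol.1 vsol.1) u0' v0 subrr.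
have hs : - h <= s by apply: le_trans ts; rewrite lerBrDr addNr.
apply/eqP; rewrite -subr_eq0; apply/eqP.
exact: (gsolution_unique h_gt0 N_norm L_cont BR_gt0 R_bound Delta_gt0
  Delta_le_h L_bound dsol d0 hs).
Qed.

Lemma solS0 phi : solS L R 0 phi = phi.
Proof.
by have [v [vsol v0]] := hsol_exists phi; rewrite (solS_seg vsol v0).
Qed.

Lemma solSB t phi psi : 0 <= t ->
  solS L R t (phi - psi) = solS L R t phi - solS L R t psi.
Proof.
move=> t0; have [v [vsol v0]] := hsol_exists phi.
have [u [usol u0]] := hsol_exists psi.
rewrite (solS_seg vsol v0 t0) (solS_seg usol u0 t0) -(segB h t vsol.1 usol.1).
apply: solS_seg t0; last by rewrite (segB h 0 vsol.1 usol.1) v0 u0.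
have := gsolutionB N_norm vsol usol.
by have -> : (fun=> 0 - 0 : Cn) = (fun=> 0) :> (K -> Cn)
  by apply/funext => x; rewrite subr0.
Qed.

Lemma solSZ t (a : K[i]) phi : 0 <= t ->
  solS L R t (a *: phi) = a *: solS L R t phi.
Proof.
move=> t0; have [v [vsol v0]] := hsol_exists phi.
rewrite (solS_seg vsol v0 t0) -(segZ h a t vsol.1).
apply: solS_seg t0; last by rewrite (segZ h a 0 vsol.1) v0.
have := gsolutionZ N_norm a vsol.
by have -> : (fun=> a *: 0 : Cn) = (fun=> 0) :> (K -> Cn)
  by apply/funext => x; rewrite scaler0.
Qed.

Lemma solS_add s t phi : 0 <= s -> 0 <= t ->
  solS L R (s + t) phi = solS L R s (solS L R t phi).
Proof.
move=> s0 t0; have [v [vsol v0]] := hsol_exists phi.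
rewrite (solS_seg vsol v0 t0) (solS_seg vsol v0 (addr_ge0 s0 t0)).
rewrite -(seg_shift h v t s); apply: esym; apply: solS_seg s0.
  exact: (gsolution_shift N_norm t0 vsol).
by rewrite (seg_shift h v t 0) add0r.
Qed.

(** [opnorm] only tests vectors of norm 1, so the bound is carried to other vectors by homogeneity,
    with [phi = 0] apart. *)
Lemma solS_norm_le (B t : K) phi : 0 <= t ->
  (opnorm (Ccn_norm N) (Ccn_norm N) (solS L R t) <= B%:E)%E ->
  Ccn_norm N (solS L R t phi) <= B * Ccn_norm N phi.
Proof.
move=> t0 SB.
have [p0|p0] := eqVneq (Ccn_norm N phi) 0.
  rewrite p0 mulr0 (is_norm_eq0 normC p0).
  have -> : (0 : C) = (0 : K[i]) *: 0 by rewrite scaler0.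
  by rewrite (solSZ 0 0 t0) scale0r (norm0 normC).
have Np : 0 < Ccn_norm N phi by rewrite lt_neqAle eq_sym p0 (norm_ge0 normC).
pose k := (Ccn_norm N phi)^-1.
have k0 : 0 < k by rewrite invr_gt0.
have kp1 : Ccn_norm N (k%:C *: phi) = 1.
  by rewrite (normZr normC) gtr0_norm// mulVf.
have : ((Ccn_norm N (solS L R t (k%:C *: phi)))%:E <= B%:E)%E.
  by apply: le_trans SB; apply: ereal_sup_ubound; exists (k%:C *: phi).
rewrite lee_fin (solSZ _ _ t0) (normZr normC) gtr0_norm//.
by rewrite /k mulrC ler_pdivrMr.
Qed.

Local Opaque solS.

(* Replaces the variation-of-constants formula: on a short interval the forcing
   moves the solution off the semigroup orbit by at most the integral of |q|. *)
Lemma gsolution_step q w (a e : K) (G g : K -> K) : gsolution L R q w ->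
  0 <= a -> 0 <= e <= Delta ->
  (forall t, 0 <= t <= e -> is_derive t 1 G (g t)) ->
  (forall t, 0 <= t <= e -> N (q (t + a)) <= g t) ->
  Ccn_norm N (seg h w (e + a) - solS L R e (seg h w a)) * (1 - BR * e)
    <= G e - G 0.
Proof.
move=> wsol a0 e0D dG qg; have [v [vsol v0]] := hsol_exists (seg h w a).
have /andP[e0 _] := e0D.
have wa := gsolution_shift N_norm a0 wsol.
have zsol := gsolutionB N_norm wa vsol.
rewrite (solS_seg vsol v0 e0) -(seg_shift h w a e) -(segB h e wa.1 vsol.1).
apply: (gsolution_norm_le h_gt0 N_norm L_cont BR_gt0 R_bound
  Delta_le_h L_bound zsol _ e0D dG).
- by rewrite (segB h 0 wa.1 vsol.1) (seg_shift h w a 0) add0r v0 subrr.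
- by move=> t te; rewrite subr0; exact: qg.
Qed.

(** * The growth bound along a subdivision *)

Context (c gamma : K) (c_ge0 : 0 <= c).
Context (S_bound : forall t : K, 0 <= t ->
     (opnorm (Ccn_norm N) (Ccn_norm N) (solS L R t)
        <= (c * expR (gamma * t))%:E)%E).

Let telescope_step (c0 W j0 j1 j2 A E x y : K) : A * E = x * y ->
  c0 * x * (W + y * (j1 - j0)) + c0 * A * (E * (j2 - j1)) =
  c0 * x * (W + y * (j2 - j0)).
Proof.
move=> AE; have -> : c0 * A * (E * (j2 - j1)) =
  c0 * (A * E) * (j2 - j1) by ring.
by rewrite AE; ring.
Qed.

Lemma gsolution_steps_norm_le q w (J : K -> K) (e t : K) k :
  gsolution L R q w -> 0 <= e <= Delta -> BR * e < 1 -> k%:R * e <= t ->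
  (forall s, 0 <= s <= t ->
     is_derive s 1 J (expR (- (gamma * s)) * N (q s))) ->
  Ccn_norm N (solS L R (t - k%:R * e) (seg h w (k%:R * e))) * (1 - BR * e) <=
  c * expR (gamma * t) * (Ccn_norm N (seg h w 0) * (1 - BR * e)
    + expR (`|gamma| * e) * (J (k%:R * e) - J 0)).
Proof.
move=> wsol eD BRe + dJ; have /andP[e0 _] := eD.
have BRe' : 0 < 1 - BR * e by rewrite subr_gt0.
elim: k => [|k IH] kt.
  rewrite mul0r subr0 subrr mulr0 addr0 mulrA ler_pM2r//.
  have t0 : 0 <= t by rewrite mul0r in kt.
  exact: solS_norm_le t0 (S_bound t0).
set a := k%:R * e in IH *.
have a0 : 0 <= a by rewrite mulr_ge0.
have aS : k.+1%:R * e = e + a by rewrite -natr1 mulrDl mul1r addrC.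
rewrite aS in kt *.
have at_ : a <= t by apply: le_trans kt; rewrite lerDr.
have r0 : 0 <= t - (e + a) by rewrite subr_ge0.
have {}IH := IH at_.
(* Chosen so that [E * expR (- (gamma * (s + a)))] is at least 1 for [0 <= s <= e], whatever the
   sign of [gamma]; then [E * J (s + a)] is the primitive of a majorant of |q|. *)
pose E := expR (gamma * (e + a) + `|gamma| * e).
pose d := seg h w (e + a) - solS L R e (seg h w a).
(* By the semigroup law, consecutive terms differ by the image of the one-step error [d]. *)
have split_ : solS L R (t - (e + a)) (seg h w (e + a)) =
    solS L R (t - a) (seg h w a) + solS L R (t - (e + a)) d.
  have tE : t - a = t - (e + a) + e by ring.
  have E1 := etrans (congr1 (fun x => solS L R x (seg h w a)) tE)
    (solS_add (seg h w a) r0 e0).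
  apply: etrans (congr2 +%R (esym E1) (esym (solSB _ _ r0))).
  by apply: esym; exact: subrKC.
have dG s : 0 <= s <= e -> is_derive s 1 (fun s => E * J (s + a))
    (E * (expR (- (gamma * (s + a))) * N (q (s + a)))).
  move=> /andP[s0 se]; apply: is_deriveZ.
  have sa : 0 <= s + a <= t by rewrite addr_ge0//= (le_trans _ kt)// lerD2r.
  have dsh : is_derive s 1 (fun x => x + a) 1.
    by rewrite -[X in is_derive _ _ _ X]addr0; exact: is_deriveD.
  have := @is_derive1_comp _ J (fun x => x + a) s _ _ (dJ _ sa) dsh.
  by rewrite mulr1.
have qg s : 0 <= s <= e ->
    N (q (s + a)) <= E * (expR (- (gamma * (s + a))) * N (q (s + a))).
  move=> /andP[s0 se]; rewrite mulrA -expRD ler_peMl ?(norm_ge0 N_norm)//.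
  rewrite -[X in X <= _]expR0 ler_expR.
  have -> : gamma * (e + a) + `|gamma| * e - gamma * (s + a) =
     gamma * (e - s) + `|gamma| * e by ring.
  have g0 : 0 <= gamma + `|gamma|.
    by rewrite -lerBlDl sub0r ler_normr lexx orbT.
  have -> : gamma * (e - s) + `|gamma| * e =
     (gamma + `|gamma|) * (e - s) + `|gamma| * s by ring.
  by apply: addr_ge0; rewrite mulr_ge0 ?subr_ge0.
have Hd : Ccn_norm N d * (1 - BR * e) <= E * (J (e + a) - J a).
  have := gsolution_step wsol a0 eD dG qg.
  by rewrite add0r -mulrBr.
have HS := solS_norm_le d r0 (S_bound r0).
rewrite split_.
apply: le_trans (ler_wpM2r (ltW BRe') (is_normD normC _ _)) _.
rewrite mulrDl.
apply: le_trans (lerD IH (ler_wpM2r (ltW BRe') HS)) _.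
rewrite -(mulrA (c * _)).
apply: le_trans (lerD (lexx _) (ler_wpM2l _ Hd)) _.
  by rewrite mulr_ge0// expR_ge0.
have Ee : expR (gamma * (t - (e + a))) * E =
    expR (gamma * t) * expR (`|gamma| * e).
  by rewrite /E -!expRD; congr expR; ring.
have H := telescope_step c (Ccn_norm N (seg h w 0) * (1 - BR * e)) (J 0) (J a)
  (J (e + a)) Ee.
exact: (eq_ind_r (fun z => z <= _) (lexx _) H).
Qed.

Lemma gsolution_norm_le_integral q w (J : K -> K) t :
  gsolution L R q w -> 0 <= t ->
  (forall s, 0 <= s <= t ->
     is_derive s 1 J (expR (- (gamma * s)) * N (q s))) ->
  Ccn_norm N (seg h w t) <=
  c * expR (gamma * t) * (Ccn_norm N (seg h w 0) + (J t - J 0)).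
Proof.
move=> wsol t0 dJ.
apply: (le_of_subdivisions t0 Delta_gt0 BR_gt0 (g := `|gamma|)) => m e.
move=> mt eD BRe; have e0 : 0 <= e by rewrite /e divr_ge0.
have eD' : 0 <= e <= Delta by rewrite e0.
have met : m.+1%:R * e <= t by rewrite mt.
have H := gsolution_steps_norm_le wsol eD' BRe met dJ.
rewrite mt subrr in H; apply: le_trans H.
apply: ler_wpM2r; first by rewrite subr_ge0 ltW.
(* At the last subdivision point the remaining time is 0. *)
have E := solS0 (seg h w t).
exact: (eq_ind_r (fun z => Ccn_norm N (seg h w t) <= Ccn_norm N z) (lexx _) E).
Qed.

End Semigroup.

(** For [0 < t] this is the fundamental theorem of calculus; on the degenerate interval the
    left-hand side is 0 and the integral is nonnegative. *)
Lemma primitive_le_integral {K : realType} (f F : K -> K) (t : K) : 0 <= t ->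
  continuous f -> (forall s : K, 0 <= s -> 0 <= f s) ->
  (forall s : K, 0 <= s -> is_derive s 1 F (f s)) ->
  F t - F 0 <= \int[lebesgue_measure]_(s in `[0, t]) f s.
Proof.
rewrite le_eqVlt => /predU1P[<-|t0] cf f0 dF.
  rewrite subrr; apply: Rintegral_ge0 => s; rewrite /= in_itv/= => /andP[s0 _].
  exact: f0.
have cF s : 0 <= s -> {for s, continuous F}.
  by move=> s0; exact: is_derive_continuous (dF _ s0).
rewrite /Rintegral (@continuous_FTC2 _ f F)//.
- exact: continuous_subspaceT.
- split.
  + by move=> s; rewrite in_itv/= => /andP[/ltW/dF[]].
  + by apply: cvg_at_right_filter; exact: cF.
  + by apply: cvg_at_left_filter; exact: cF (ltW t0).
- move=> s; rewrite in_itv/= => /andP[/ltW s0 _].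
  by have := dF _ s0; rewrite derive1E => /@derive_val.
Qed.

Theorem corollary6p4 (K : realType) (n : nat) (h : K) (h_gt0 : 0 < h)
  (N : 'cV[K[i]]_n -> K) (N_norm : is_norm N)
  (L R : {linear Ccn h n -> 'cV[K[i]]_n})
  (L_cont : continuous_for_norms (Ccn_norm N) N L)
  (R_cont : continuous_for_norms (Ccn_norm N) N R)
  (L_delay : exists Delta : K, 0 < Delta < h /\
     forall phi : Ccn h n,
       (forall s : Ih h, set_val s <= - Delta -> phi s = 0) -> L phi = 0)
  (q : K -> 'cV[K[i]]_n) (q_cont : {within `[0, +oo[, continuous q})
  (c gamma : K) (c_ge0 : 0 <= c)
  (S_bound : forall t : K, 0 <= t ->
     (opnorm (Ccn_norm N) (Ccn_norm N) (solS L R t)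
        <= (c * expR (gamma * t))%:E)%E)
  (phi : Ccn h n) (w : K -> 'cV[K[i]]_n)
  (w_sol : is_solution_from L R q phi w)
  (t : K) (t_ge0 : 0 <= t) :
  N (w t) <= c * (expR (gamma * t) * Ccn_norm N phi
    + n%:R * \int[lebesgue_measure]_(s in `[0, t])
               (expR (gamma * (t - s)) * N (q s))).
Proof.
have h_ge0 : 0 <= h := ltW h_gt0.
have NC := Ccn_norm_is_norm h_ge0 N_norm.
have [BR BR0 R_bound] := continuous_linear_bounded NC N_norm R_cont.
have [Delta [/andP[Delta0 Dh] LD]] := L_delay.
have [BL BL0 L_bound] := delayed_linear_bounded h_ge0 N_norm L_cont (ltW Dh) LD.
have [w_sol' w0] := w_sol.
have [Wsol WE] := is_solution_gsolution h_gt0 N_norm w_sol'.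
set W := (fun t => w (Num.max t (- h))) in Wsol WE.
(* [q] is continuous only on [0, +oo[; freezing it at 0 provides a globally continuous integrand. *)
pose f (s : K) := expR (- (gamma * s)) * N (q (Num.max s 0)).
have cf : continuous f.
  move=> s; apply: (@continuousM _ _ (fun s : K => expR (- (gamma * s)))
    (fun s : K => N (q (Num.max s 0)))).
    apply: (@continuous_comp _ _ _ (fun s => - (gamma * s)) expR);
      last exact: continuous_expR.
    apply: (@continuousN _ _ _ (fun s => gamma * s)).
    by apply: (@continuousM _ _ (cst gamma) (fun x => x));
      [exact: cst_continuous|exact: cvg_id].
  have cq := continuous_within_max q_cont.
  exact: (continuous_norm N_norm (cq s)).
have f0 s : 0 <= f s by rewrite mulr_ge0 ?expR_ge0//; exact: norm_ge0.
have [J dJ] := continuous_primitive cf.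
have dJ' s : 0 <= s <= t -> is_derive s 1 J (expR (- (gamma * s)) * N (q s)).
  by move=> /andP[s0 _]; have := dJ _ s0; rewrite /f max_l.
have HW := gsolution_norm_le_integral h_gt0 N_norm L_cont R_cont BR0 R_bound BL0
  Delta0 (ltW Dh) L_bound c_ge0 S_bound Wsol t_ge0 dJ'.
rewrite (WE 0 (lexx 0)) w0 in HW.
have wW : N (w t) <= Ccn_norm N (seg h W t).
  have := norm_le_Ccn_norm h_ge0 N_norm (seg h W t) (clamp h_ge0 0).
  rewrite (segE t (clamp h_ge0 0) Wsol.1) set_val_clamp; last first.
    by rewrite oppr_le0 h_ge0 lexx.
  rewrite addr0 /W max_l//.
  by apply: le_trans t_ge0; rewrite oppr_le0.
pose I := \int[lebesgue_measure]_(s in `[0, t])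
  (expR (gamma * (t - s)) * N (q s)).
have I0 : 0 <= I.
  apply: Rintegral_ge0 => s _; rewrite mulr_ge0 ?expR_ge0//; exact: norm_ge0.
have JI : expR (gamma * t) * (J t - J 0) <= I.
  rewrite mulrBr.
  apply: le_trans (primitive_le_integral (f := fun s => expR (gamma * t) * f s)
    (F := fun s => expR (gamma * t) * J s) t_ge0 _ _ _) _.
  - move=> s; apply: (@continuousM _ _ (cst (expR (gamma * t))) f);
      [exact: cst_continuous|exact: cf].
  - by move=> s _; rewrite mulr_ge0// expR_ge0.
  - by move=> s s0; have := dJ _ s0 => dJs; exact: is_deriveZ.
  - rewrite le_eqVlt; apply/orP; left; apply/eqP; apply: eq_Rintegral => s.
    rewrite inE/= in_itv/= => /andP[s0 _].
    by rewrite /f max_l// mulrA -expRD mulrBr.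
rewrite -/I.
(* For [n > 0] the factor [n] enters through [1 <= n] and [0 <= I]. For [n = 0] this fails, but C^0
   is trivial and [w t = 0]. *)
have [n0|n0] := posnP n.
  have -> : w t = 0.
    by apply/matrixP => j; have := ltn_ord j; rewrite [X in (_ < X)%N]n0.
  rewrite (norm0 N_norm); apply: mulr_ge0 => //; apply: addr_ge0.
    by apply: mulr_ge0; [exact: expR_ge0|exact: (norm_ge0 NC)].
  by apply: mulr_ge0.
apply: le_trans wW (le_trans HW _).
rewrite -mulrA ler_wpM2l// mulrDr lerD2l (le_trans JI)// ler_peMl//.
by rewrite ler1n.
Qed.
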